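(* Let $\alpha_0,\alpha_1,\ldots,\alpha_r$ be integers and suppose there exists at least one perfect matroid design whose flats of rank $i$ all have size $\alpha_i$ ($0\le i\le r$). Then the perfect matroid designs with this sequence are precisely the rank-$r$ matroids on $\alpha_r$ elements that maximize $N\mapsto F_{0,r}(N;\alpha_0,\alpha_1,\ldots,\alpha_r)$ among all rank-$r$ matroids on $\alpha_r$ elements. In particular, for $r\ge 4$ and a prime power $q$, among all simple rank-$r$ matroids on $\frac{q^r-1}{q-1}$ elements, $\mathrm{PG}(r-1,q)$ is the unique matroid (up to isomorphism) maximizing $N\mapsto F_{0,r}(N;0,1,q+1,q^2+q+1,\ldots,\frac{q^r-1}{q-1})$; and among simple rank-$r$ matroids on $q^{r-1}$ elements, $\mathrm{AG}(r-1,q)$ is the unique matroid maximizing $N\mapsto F_{0,r}(N;0,1,q,q^2,\ldots,q^{r-1})$.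
   Context: All matroids are finite. A perfect matroid design is a matroid $M$ for which there are integers $\alpha_0,\ldots,\alpha_{r(M)}$ with $|F|=\alpha_{r(F)}$ for every flat $F$. For a matroid $N$ of rank $r$ and integers $s_0,\ldots,s_r$, $F_{0,r}(N;s_0,\ldots,s_r)$ denotes the number of chains $F_0\subsetneq F_1\subsetneq\cdots\subsetneq F_r$ of flats of $N$ with $r(F_i)=i$ and $|F_i|=s_i$ for all $i$ (this is a valuative invariant). *)

(* Defs.v *)
From mathcomp Require Import all_boot all_algebra.

Set Implicit Arguments.
Unset Strict Implicit.
Unset Printing Implicit Defensive.

Import GRing.Theory.

Record matroid (T : finType) := Matroid {
  indep : {set {set T}};
  indep0 : set0 \in indep;
  indepS : forall A B : {set T}, A \subset B -> B \in indep -> A \in indep;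
  indepU : forall A B : {set T}, A \in indep -> B \in indep -> #|A| < #|B| ->
    exists2 x, x \in B :\: A & x |: A \in indep }.

Section MatroidNotions.
Variables (T : finType) (M : matroid T).

Definition rk (A : {set T}) : nat :=
  \max_(I in indep M | I \subset A) #|I|.

Definition rank : nat := rk [set: T].

Definition flat (A : {set T}) : bool :=
  [forall x, (x \notin A) ==> (rk A < rk (x |: A))].

Definition circuit (C : {set T}) : bool :=
  minset (fun A : {set T} => A \notin indep M) C.

Definition simple : Prop :=
  (forall x, ~~ circuit [set x]) /\
  (forall x y, x != y -> ~~ circuit [set x; y]).

(* F_{0,r}(M; s 0, ..., s r); a chain is the function i |-> F_i, and only the
   values s 0, ..., s r matter. *)
Definition chain_count (r : nat) (s : nat -> nat) : nat :=
  #|[set C : {ffun 'I_r.+1 -> {set T}} |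
      [forall i : 'I_r.+1, [&& flat (C i), rk (C i) == i & #|C i| == s i]] &&
      [forall i : 'I_r.+1, forall j : 'I_r.+1, (i < j) ==> (C i \proper C j)]]|.

Definition perfect_matroid_design (r : nat) (alpha : nat -> nat) : Prop :=
  rank = r /\ forall A, flat A -> #|A| = alpha (rk A).

End MatroidNotions.

Definition isomorphic (T U : finType) (M : matroid T) (N : matroid U) : Prop :=
  exists2 f : T -> U, bijective f &
    forall A : {set T}, (f @: A \in indep N) = (A \in indep M).

Definition matroid_class := forall T : finType, matroid T -> Prop.

Definition rank_size_class (r n : nat) : matroid_class :=
  fun T M => rank M = r /\ #|T| = n.

Definition simple_rank_size_class (r n : nat) : matroid_class :=
  fun T M => simple M /\ rank_size_class r n M.

Definition maximizes (f : forall T : finType, matroid T -> nat)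
    (P : matroid_class) (T : finType) (M : matroid T) : Prop :=
  P T M /\ forall (U : finType) (N : matroid U), P U N -> f U N <= f T M.

Definition unique_maximizer (f : forall T : finType, matroid T -> nat)
    (P : matroid_class) (T : finType) (M : matroid T) : Prop :=
  maximizes f P M /\
  forall (U : finType) (N : matroid U), maximizes f P N -> isomorphic N M.

Section VectorMatroid.
Variables (K : fieldType) (vT : vectType K) (T : finType) (phi : T -> vT).

Definition vector_indep : {set {set T}} :=
  [set A : {set T} | free [seq phi x | x <- enum A]].

Lemma vector_indep0 : set0 \in vector_indep.
Proof. by rewrite inE enum_set0 nil_free. Qed.

Lemma vector_indepS (A B : {set T}) :
  A \subset B -> B \in vector_indep -> A \in vector_indep.
Proof.
move=> sAB; rewrite !inE => freeB.
have pB : perm_eq (enum B) (enum A ++ enum (B :\: A)).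
  apply: uniq_perm; rewrite ?enum_uniq // ?cat_uniq ?enum_uniq ?andbT //=.
    by apply/hasPn=> x; rewrite !mem_enum inE => /andP[].
  move=> x; rewrite mem_cat !mem_enum inE.
  by case: (boolP (x \in A)) => //= /(subsetP sAB).
move: freeB; rewrite (perm_free (perm_map phi pB)) map_cat; exact: catl_free.
Qed.

Lemma vector_indepU (A B : {set T}) :
  A \in vector_indep -> B \in vector_indep -> #|A| < #|B| ->
  exists2 x, x \in B :\: A & x |: A \in vector_indep.
Proof.
rewrite !inE => freeA freeB ltAB.
have [x /andP[xB xA]|noext] :=
    pickP [pred x | (x \in B) && (phi x \notin <<[seq phi y | y <- enum A]>>%VS)].
  have xnA : x \notin A.
    by apply: contra xA => xA; apply/memv_span/map_f; rewrite mem_enum.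
  exists x; first by rewrite inE xnA.
  have pA : perm_eq (enum (x |: A)) (x :: enum A).
    apply: uniq_perm; rewrite /= ?enum_uniq ?mem_enum ?xnA //.
    by move=> y; rewrite inE !mem_enum !inE.
  by rewrite inE (perm_free (perm_map phi pA)) /= free_cons xA.
have: (<<[seq phi y | y <- enum B]>> <= <<[seq phi y | y <- enum A]>>)%VS.
  apply/span_subvP=> v /mapP[y]; rewrite mem_enum => yB ->.
  by have:= noext y; rewrite /= yB /= => /negbFE.
move/dimvS; rewrite (eqP freeA) (eqP freeB) !size_map -!cardE.
by rewrite leqNgt ltAB.
Qed.

Definition vector_matroid : matroid T :=
  Matroid vector_indep0 vector_indepS vector_indepU.

End VectorMatroid.

Section Geometries.
Variables (F : finFieldType) (n : nat).

(* The 1-dimensional subspaces of F^(n+1); genmx makes the square matrix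
   spanning a given subspace unique. *)
Definition pg_point : finType :=
  {A : 'M[F]_n.+1 | (\rank A == 1) && (<<A>>%MS == A)}.

(* nz_row picks a nonzero vector of the subspace. *)
Definition PG : matroid pg_point :=
  vector_matroid (fun p : pg_point => nz_row (val p)).

(* Affine independence of points v of F^n is linear independence of the
   vectors (1, v). *)
Definition AG : matroid 'rV[F]_n :=
  vector_matroid (fun v : 'rV[F]_n => row_mx (1%:M : 'M_1) v).

End Geometries.

Definition prime_power (q : nat) : Prop :=
  exists p k, [/\ prime p, 0 < k & q = p ^ k].

Definition pg_sizes (q i : nat) : nat := (q ^ i - 1) %/ (q - 1).

Definition ag_sizes (q i : nat) : nat := if i is j.+1 then q ^ j else 0.

(* Main.v *)
(** Adding to a flat [A] of rank [i] the points outside it, one sees that the covers of [A]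
partition the complement of [A]. Hence the number of good chains of length [i+1] times
[s (i+1) - s i] is at most the number of good chains of length [i] times [s r - s i], with
equality for all [i] exactly when every flat has the prescribed size. This gives the first
claim.

For the other two, a perfect matroid design with the sizes of [PG] or [AG] satisfies, by
counting, the axioms of a projective or affine geometry of dimension at least 3. For [PG] one
removes a hyperplane [H], whose points become the directions of the affine part. Desargues'
theorem for central collineations (translations and homotheties treated at once) follows
from the third dimension; the translations turn the points into an abelian group, the
direction-preserving endomorphisms form a finite division ring with as many elements as a
line, and Wedderburn's theorem together with the uniqueness of finite fields identifies it with
[F]. In the resulting coordinates flats are subspaces, and two perfect matroid designs with
the same sizes are isomorphic as soon as a bijection maps flats to flats. *)

From HB Require Import structures.
From mathcomp Require Import all_boot all_fingroup all_algebra all_solvable all_field.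
From mathcomp Require Import zify.
Require Import Defs.
From mathcomp Require Import all_boot all_algebra.

Set Implicit Arguments.
Unset Strict Implicit.
Unset Printing Implicit Defensive.

Import GRing.Theory.

(** * Closure in matroids *)

(** Both geometries are fed into one interface, [affine_geometry], which speaks only of points, of
    directions, and of the lines that join directions at infinity; coordinates are built once, from
    that interface. Its axiom [ln_dim], that infinity is more than a line, is where [r >= 4] enters,
    because a plane need not be Desarguesian.

    The incidence axioms come from sizes, mainly through [join_cover], a dimension formula obtained
    by counting. Over the empty flat it makes subspaces meet, which is what the projective case
    needs. In the affine case subspaces may be parallel, so the formula is applied over a common
    point. When [#|F| = 2], affine lines have only two points and carry no information; parallelism
    is therefore defined through planes, and its transitivity draws on the sizes of flats of rank
    4. *)

Lemma setU1_id (T : finType) (x : T) (A : {set T}) : x \in A -> x |: A = A.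
Proof. by move=> xA; apply/setUidPr; rewrite sub1set. Qed.

Lemma card_bigcup_disjoint (I T : finType) (P : {set I}) (F : I -> {set T}) :
  {in P &, forall i j, i != j -> [disjoint F i & F j]} ->
  #|\bigcup_(i in P) F i| = \sum_(i in P) #|F i|.
Proof.
move=> dF; rewrite -sum1_card [\bigcup_(i in P) _]big_mkcond [RHS]big_mkcond /=.
rewrite partition_disjoint_bigcup => [|i j ne].
  by apply: eq_bigr => i _; case: (boolP (i \in P)); rewrite sum1_card ?cards0.
by do 2?case: ifP => ?; rewrite ?dF // -setI_eq0 ?setI0 ?set0I.
Qed.

Section Closure.
Variables (T : finType) (M : matroid T).
Implicit Types (A B I : {set T}) (x y : T).

(** Locked so that unification never unfolds a closure; [in_cl] is the only access to its body. *)
Fact cl_key : unit. Proof. by []. Qed.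
Definition cl A : {set T} := locked_with cl_key [set x | rk M (x |: A) == rk M A].

Lemma in_cl A x : (x \in cl A) = (rk M (x |: A) == rk M A).
Proof. by rewrite /cl locked_withE inE. Qed.

Lemma indep_le_rk A I : I \in indep M -> I \subset A -> #|I| <= rk M A.
Proof. by move=> iI sIA; apply: (bigmax_sup I); rewrite ?iI. Qed.

Lemma rk_basis A : exists2 I, I \in indep M & I \subset A /\ #|I| = rk M A.
Proof.
have P0 : (set0 \in indep M) && (set0 \subset A) by rewrite indep0 sub0set.
have [I /andP[iI sI] eI] :=
  eq_bigmax_cond (fun I : {set T} => #|I|) (ltac:(by apply/card_gt0P; exists set0)
   : 0 < #|[pred I | (I \in indep M) && (I \subset A)]|).
by exists I => //; split.
Qed.

Lemma rk_le_card A : rk M A <= #|A|.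
Proof. by have [I _ [sI <-]] := rk_basis A; apply: subset_leq_card. Qed.

Lemma rk_indep I : I \in indep M -> rk M I = #|I|.
Proof. by move=> iI; apply/eqP; rewrite eqn_leq rk_le_card indep_le_rk. Qed.

Lemma indep_rk I : (I \in indep M) = (rk M I == #|I|).
Proof.
apply/idP/eqP; first exact: rk_indep.
have [J iJ [sJ <-]] := rk_basis I => e.
suff -> : I = J by [].
by apply/esym/eqP; rewrite eqEcard sJ e leqnn.
Qed.

Lemma rkS A B : A \subset B -> rk M A <= rk M B.
Proof.
move=> sAB; have [I iI [sI <-]] := rk_basis A.
by apply: indep_le_rk => //; apply: subset_trans sAB.
Qed.

Lemma indep_extend A I : I \in indep M -> I \subset A ->
  exists2 B, B \in indep M & [/\ I \subset B, B \subset A & #|B| = rk M A].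
Proof.
have [k] := ubnP (rk M A - #|I|); elim: k I => // k IHk I ltk iI sIA.
have [e|ne] := eqVneq #|I| (rk M A); first by exists I.
have ltI : #|I| < rk M A by rewrite ltn_neqAle ne indep_le_rk.
have [J iJ [sJ eJ]] := rk_basis A.
have [x] := indepU iI iJ (ltac:(by rewrite eJ) : #|I| < #|J|).
rewrite inE => /andP[xI xJ] iX.
have sX : x |: I \subset A by rewrite subUset sub1set (subsetP sJ).
have [|B iB [sB sBA eB]] := IHk _ _ iX sX.
  by rewrite cardsU1 xI; lia.
by exists B => //; split=> //; apply: subset_trans sB; apply: subsetUr.
Qed.

Lemma rkU1_le x A : rk M (x |: A) <= (rk M A).+1.
Proof.
have [I iI [sI <-]] := rk_basis (x |: A).
have iD : I :\ x \in indep M by apply: indepS iI; apply: subsetDl.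
have := indep_le_rk (A := A) iD.
rewrite subDset => /(_ sI); have := cardsD1 x I; case: (x \in I); lia.
Qed.

Lemma sub_cl A : A \subset cl A.
Proof. by apply/subsetP=> x xA; rewrite in_cl setU1_id. Qed.

Lemma rkU1 x A : rk M (x |: A) = rk M A + (x \notin cl A).
Proof.
rewrite in_cl; have := rkU1_le x A; have := rkS (subsetUr [set x] A).
by case: eqP => /=; lia.
Qed.

(** Otherwise exchange would extend a basis of [A] by some [x] of the closure to an independent
    subset of [x |: A], although adding [x] does not raise the rank. *)
Lemma rk_cl A : rk M (cl A) = rk M A.
Proof.
apply/eqP; rewrite eqn_leq (rkS (sub_cl A)) andbT leqNgt; apply/negP=> lt.
have [I iI [sI eI]] := rk_basis A; have [J iJ [sJ eJ]] := rk_basis (cl A).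
have [x] := indepU iI iJ (ltac:(by rewrite eI eJ) : #|I| < #|J|).
rewrite inE => /andP[xI xJ] iX.
have := subsetP sJ _ xJ; rewrite in_cl => /eqP e.
have := indep_le_rk (A := x |: A) iX.
by rewrite setUS // cardsU1 xI e eI => /(_ isT); lia.
Qed.

(** Closure is tested on a single basis, so monotonicity of [cl] reduces to extending a basis of the
    smaller set. *)
Lemma cl_basis I A x : I \in indep M -> I \subset A -> #|I| = rk M A ->
  (x \notin cl A) = (x \notin I) && (x |: I \in indep M).
Proof.
move=> iI sI eI; apply/idP/andP => [xA|[xI iX]].
  have xI : x \notin I.
    by apply: contra xA => xI; apply: (subsetP (sub_cl A)); apply: (subsetP sI).
  split=> //.
  have [J iJ [sIJ sJ eJ]] := indep_extend iI (subset_trans sI (subsetUr [set x] A)).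
  have e : #|J| = #|I|.+1 by rewrite eJ rkU1 xA eI addn1.
  suff -> : x |: I = J by [].
  apply/eqP; rewrite eqEcard cardsU1 xI e leqnn andbT subUset sIJ andbT sub1set.
  apply: contraT => xJ.
  have : J \subset A.
    apply/subsetP=> y yJ; have := subsetP sJ y yJ; rewrite inE => /orP[|//].
    by rewrite inE => /eqP yx; rewrite -yx yJ in xJ.
  by move/(indep_le_rk iJ); rewrite e eI ltnn.
rewrite in_cl; apply/eqP=> e.
have := indep_le_rk (A := x |: A) iX.
by rewrite setUS // cardsU1 xI e eI => /(_ isT); lia.
Qed.

Lemma clS A B : A \subset B -> cl A \subset cl B.
Proof.
move=> sAB; apply/subsetP=> x; apply: contraLR.
have [I iI [sI eI]] := rk_basis A.
have [J iJ [sIJ sJ eJ]] := indep_extend iI (subset_trans sI sAB).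
rewrite (cl_basis x iI sI eI) (cl_basis x iJ sJ eJ) => /andP[xJ iX].
rewrite (contra (subsetP sIJ x) xJ); apply: indepS iX; exact: setUS.
Qed.

Lemma cl_eq_rk A B : A \subset B -> rk M A = rk M B -> cl A = cl B.
Proof.
move=> sAB e; apply/eqP; rewrite eqEsubset clS //.
apply/subsetP=> x; rewrite !in_cl -e => /eqP e'.
by rewrite eqn_leq -{1}e' !rkS ?setUS ?subsetUr.
Qed.

Lemma cl_id A : cl (cl A) = cl A.
Proof. by apply/esym/cl_eq_rk; rewrite ?sub_cl ?rk_cl. Qed.

Lemma flatP A : reflect (cl A = A) (flat M A).
Proof.
apply: (iffP forallP) => [fA|eA x].
  apply/eqP; rewrite eqEsubset sub_cl andbT; apply/subsetP=> x.
  by apply: contraLR => xA; have := fA x; rewrite xA /= in_cl neq_ltn orbC => ->.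
by apply/implyP=> xA; rewrite rkU1 eA xA addn1.
Qed.

Lemma flat_cl A : flat M (cl A).
Proof. by apply/flatP; rewrite cl_id. Qed.

Lemma cl_sub A B : flat M B -> A \subset B -> cl A \subset B.
Proof. by move=> /flatP fB /clS; rewrite fB. Qed.

Lemma flat_rk_eq A B : flat M A -> flat M B -> A \subset B -> rk M B <= rk M A -> A = B.
Proof.
move=> /flatP fA /flatP fB sAB le; rewrite -fA -fB; apply: cl_eq_rk => //.
by apply/eqP; rewrite eqn_leq rkS.
Qed.

Lemma flat_rk_lt A B : flat M A -> A \proper B -> rk M A < rk M B.
Proof.
move=> /flatP fA /properP[sAB [x xB xA]].
apply: leq_trans (rkS (_ : x |: A \subset B)); last by rewrite subUset sub1set xB.
by rewrite rkU1 fA xA addn1.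
Qed.

Lemma flatI A B : flat M A -> flat M B -> flat M (A :&: B).
Proof.
move=> fA fB; apply/flatP/eqP; rewrite eqEsubset sub_cl andbT subsetI.
by rewrite (cl_sub fA) ?subsetIl // (cl_sub fB) ?subsetIr.
Qed.

Lemma flatT : flat M [set: T].
Proof. by apply/flatP/eqP; rewrite eqEsubset sub_cl subsetT. Qed.

Lemma rk_setT : rk M [set: T] = rank M. Proof. by []. Qed.

Lemma rk0 : rk M set0 = 0.
Proof. by apply/eqP; have := rk_le_card set0; rewrite cards0 leqn0. Qed.

Lemma cl_clU A B : cl (cl A :|: B) = cl (A :|: B).
Proof.
apply/eqP; rewrite eqEsubset [X in _ && X]clS ?setSU ?sub_cl // andbT.
rewrite cl_sub ?flat_cl // subUset clS ?subsetUl //=.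
by apply: subset_trans (sub_cl _); apply: subsetUr.
Qed.

Lemma cl_clU1 x A : cl (x |: cl A) = cl (x |: A).
Proof. by rewrite setUC cl_clU setUC. Qed.

Lemma cl_exchange x y A : y \in cl (x |: A) -> y \notin cl A ->
  cl (y |: A) = cl (x |: A).
Proof.
move=> yx yA; have xA : x \notin cl A.
  apply: contra yA => xA; move: yx; rewrite -cl_clU1 (setU1_id xA) cl_id //.
have s : y |: A \subset cl (x |: A).
  by rewrite subUset sub1set yx (subset_trans _ (sub_cl _)) ?subsetUr.
by rewrite (cl_eq_rk s) ?cl_id // rk_cl !rkU1 xA yA.
Qed.

Lemma rk_clU1 x A : flat M A -> x \notin A -> rk M (cl (x |: A)) = (rk M A).+1.
Proof. by move=> /flatP fA xA; rewrite rk_cl rkU1 fA xA addn1. Qed.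

Lemma in_cl_U1 x A : x \in cl (x |: A).
Proof. by rewrite (subsetP (sub_cl _)) ?setU11. Qed.

Lemma sub_cl_U1 x A : A \subset cl (x |: A).
Proof. by apply: subset_trans (sub_cl _); apply: subsetUr. Qed.

(** A cover is determined by any one of its points outside [A]; hence distinct covers of [A] meet
    only in [A]. *)
Lemma cover_cl A B x : flat M A -> flat M B -> A \subset B -> rk M B = (rk M A).+1 ->
  x \in B -> x \notin A -> B = cl (x |: A).
Proof.
move=> fA fB sAB e xB xA; apply/esym/flat_rk_eq; rewrite ?flat_cl //.
  by rewrite cl_sub // subUset sub1set xB.
by rewrite rk_clU1 // e.
Qed.

Lemma exists_flat_below A k : flat M A -> k <= rk M A ->
  exists2 B, flat M B & B \subset A /\ rk M B = k.
Proof.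
move=> fA; elim: k => [|k IHk] lek.
  exists (cl set0); first exact: flat_cl.
  by rewrite cl_sub ?sub0set // rk_cl rk0.
have [B fB [sB e]] := IHk (ltnW lek).
have /subsetPn[x xA xB] : ~~ (A \subset B).
  by apply/negP=> /rkS; rewrite e; lia.
exists (cl (x |: B)); first exact: flat_cl.
by split; [rewrite cl_sub // subUset sub1set xA|rewrite rk_clU1 ?e].
Qed.

End Closure.

(** * Counting chains *)

Section ChainBound.
Variables (T : finType) (M : matroid T) (s : nat -> nat).

Definition good k (A : {set T}) := [&& flat M A, rk M A == k & #|A| == s k].

Definition good_chain k (C : {ffun 'I_k.+1 -> {set T}}) :=
  [forall i : 'I_k.+1, good i (C i)] &&
  [forall i : 'I_k.+1, forall j : 'I_k.+1, (i < j) ==> (C i \proper C j)].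

Definition good_covers k (A : {set T}) := [set B | good k B & A \proper B].

Lemma chain_countE k : chain_count M k s = #|[set C | good_chain (k := k) C]|.
Proof. by []. Qed.

Definition chain_snoc k (C : {ffun 'I_k.+1 -> {set T}}) B : {ffun 'I_k.+2 -> {set T}} :=
  [ffun i => if unlift ord_max i is Some j then C j else B].

Definition chain_init k (C : {ffun 'I_k.+2 -> {set T}}) : {ffun 'I_k.+1 -> {set T}} :=
  [ffun i => C (lift ord_max i)].

Lemma chain_snoc_lift k C B i : chain_snoc (k := k) C B (lift ord_max i) = C i.
Proof. by rewrite ffunE liftK. Qed.

Lemma chain_snoc_max k C B : chain_snoc (k := k) C B ord_max = B.
Proof. by rewrite ffunE unlift_none. Qed.

Lemma chain_snoc_good k C B :
  good_chain (chain_snoc (k := k) C B) =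
  good_chain C && (B \in good_covers k.+1 (C ord_max)).
Proof.
apply/andP/andP => [[/forallP g /'forall_'forall_implyP p]|[/andP[/forallP g /'forall_'forall_implyP p]]].
  split; [apply/andP; split|rewrite inE].
  - by apply/forallP=> i; have := g (lift ord_max i); rewrite chain_snoc_lift lift_max.
  - apply/'forall_'forall_implyP=> i j ij.
    by have := p (lift ord_max i) (lift ord_max j); rewrite !lift_max !chain_snoc_lift => /(_ ij).
  have := g ord_max; rewrite chain_snoc_max => -> /=.
  by have := p (lift ord_max ord_max) ord_max; rewrite lift_max chain_snoc_lift chain_snoc_max /= ltnSn => /(_ isT).
rewrite inE => /andP[gB pB]; split.
  apply/forallP=> i; case: (unliftP ord_max i) => [j|] ->.
    by rewrite chain_snoc_lift lift_max.
  by rewrite chain_snoc_max.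
apply/'forall_'forall_implyP=> i j.
case: (unliftP ord_max j) => [j'|] ->; case: (unliftP ord_max i) => [i'|] ->;
  rewrite ?lift_max ?chain_snoc_lift ?chain_snoc_max /= => ij.
- exact: p.
- by move: ij; rewrite ltnNge ltnW ?ltn_ord.
- apply: sub_proper_trans pB; have [->//|ne] := eqVneq i' ord_max.
  by apply/proper_sub/p => /=; have := ltn_ord i'; move: ne; rewrite -val_eqE /=; lia.
- by rewrite ltnn in ij.
Qed.

Lemma chain_snocK k C : chain_snoc (chain_init (k := k) C) (C ord_max) = C.
Proof. by apply/ffunP=> i; rewrite ffunE; case: unliftP => [j|] -> //; rewrite ffunE. Qed.

Lemma chain_count_step k : chain_count M k.+1 s =
  \sum_(C : {ffun 'I_k.+1 -> {set T}} | good_chain C) #|good_covers k.+1 (C ord_max)|.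
Proof.
rewrite chain_countE -sum1_card.
rewrite (partition_big (@chain_init k) (fun C => good_chain C)) /=; last first.
  by move=> C; rewrite inE -{1}(chain_snocK C) chain_snoc_good => /andP[].
apply: eq_bigr => C gC; rewrite sum1dep_card -(card_imset _ (_ : injective (chain_snoc C))).
  apply: eq_card => C'; rewrite !inE; apply/andP/imsetP => [[gC' /eqP <-]|[B gB ->]].
    exists (C' ord_max); last by rewrite chain_snocK.
    by move: gC'; rewrite -{1}(chain_snocK C') chain_snoc_good => /andP[].
  split; first by rewrite chain_snoc_good gC.
  by apply/eqP/ffunP=> i; rewrite ffunE chain_snoc_lift.
by move=> B B' /(congr1 (fun f : {ffun _} => f ord_max)); rewrite !chain_snoc_max.
Qed.

Lemma good_covers_card k A : good k A ->
  #|good_covers k.+1 A| * (s k.+1 - s k) = #|\bigcup_(B in good_covers k.+1 A) (B :\: A)|.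
Proof.
case/and3P=> fA /eqP rA /eqP cA.
have coverE B : B \in good_covers k.+1 A ->
    [/\ flat M B, rk M B = k.+1, A \subset B & #|B :\: A| = s k.+1 - s k].
  rewrite inE => /andP[/and3P[fB /eqP rB /eqP cB] /proper_sub sAB]; split=> //.
  by rewrite cardsD (setIidPr sAB) cB cA.
rewrite -sum_nat_const card_bigcup_disjoint => [|B B' /coverE[fB rB sB _] /coverE[fB' rB' sB' _] ne].
  by apply: eq_bigr => B /coverE[_ _ _ <-].
rewrite -setI_eq0; apply: contraNT ne => /set0Pn[x].
rewrite !inE => /andP[/andP[xA xB] /andP[_ xB']].
by rewrite (cover_cl fA fB sB _ xB xA) ?rA // (cover_cl fA fB' sB' _ xB' xA) ?rA.
Qed.

Lemma good_covers_sub k A :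
  \bigcup_(B in good_covers k A) (B :\: A) \subset ~: A.
Proof. by apply/bigcupsP=> B _; apply/subsetP=> x; rewrite !inE => /andP[]. Qed.

Lemma good_covers_bound k A : good k A ->
  #|good_covers k.+1 A| * (s k.+1 - s k) <= #|T| - s k.
Proof.
move=> gA; rewrite good_covers_card //; case/and3P: gA => _ _ /eqP <-.
have -> : #|T| - #|A| = #|~: A| by rewrite [RHS]cardsCs setCK.
exact: subset_leq_card (good_covers_sub _ _).
Qed.

(** In the equality case the good covers fill the complement of [A], so any cover shares an outside
    point with a good one and coincides with it. *)
Lemma good_covers_bound_eq k A B : good k A ->
  #|good_covers k.+1 A| * (s k.+1 - s k) = #|T| - s k ->
  flat M B -> rk M B = k.+1 -> A \subset B -> #|B| = s k.+1.
Proof.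
move=> gA; rewrite good_covers_card //; case/and3P: gA => fA /eqP rA /eqP <-.
have -> : #|T| - #|A| = #|~: A| by rewrite [RHS]cardsCs setCK.
move=> e fB rB sB.
have eqU : \bigcup_(B in good_covers k.+1 A) (B :\: A) = ~: A.
  by apply/eqP; rewrite eqEcard good_covers_sub e leqnn.
have /properP[_ [x xB xA]] : A \proper B.
  by rewrite properEneq sB andbT; apply/eqP=> AB; move: rB; rewrite -AB rA; lia.
have : x \in ~: A by rewrite inE.
rewrite -eqU => /bigcupP[B']; rewrite !inE => /andP[/and3P[fB' /eqP rB' /eqP <-] /proper_sub sB'] /andP[_ xB'].
by rewrite (cover_cl fA fB sB _ xB xA) ?rA // -(cover_cl fA fB' sB' _ xB' xA) ?rA.
Qed.

Lemma chain_count_step_le k :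
  chain_count M k.+1 s * (s k.+1 - s k) <= chain_count M k s * (#|T| - s k).
Proof.
rewrite chain_count_step big_distrl /= chain_countE -sum1dep_card big_distrl /=.
apply: leq_sum => C /andP[/forallP gC _]; rewrite mul1n.
exact: good_covers_bound (gC ord_max).
Qed.

Lemma chain_count_step_eq k C B :
  chain_count M k.+1 s * (s k.+1 - s k) = chain_count M k s * (#|T| - s k) ->
  good_chain (k := k) C -> flat M B -> rk M B = k.+1 -> C ord_max \subset B -> #|B| = s k.+1.
Proof.
rewrite chain_count_step big_distrl /= chain_countE -sum1dep_card big_distrl /=.
move=> e gC; have /andP[/forallP gC' _] := gC.
apply: (good_covers_bound_eq (gC' ord_max)); rewrite -[RHS]mul1n; apply/eqP.
(* Equality of the sums forces equality in every term of the one-step bound. *)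
have := @leqif_sum _ (fun C => good_chain (k := k) C)
  (fun C => #|good_covers k.+1 (C ord_max)| * (s k.+1 - s k) == 1 * (#|T| - s k))
  (fun C => #|good_covers k.+1 (C ord_max)| * (s k.+1 - s k)) (fun=> 1 * (#|T| - s k)).
case=> [C' /andP[/forallP g _]|_].
  by split=> //; rewrite mul1n; apply: good_covers_bound (g ord_max).
by rewrite e eqxx => /esym/forallP/(_ C)/implyP/(_ gC).
Qed.

(** The closure of the empty set is the only flat of rank 0, so there is at most one chain. *)
Lemma chain_count0 : chain_count M 0 s = (#|cl M set0| == s 0).
Proof.
rewrite chain_countE.
have fl A : flat M A && (rk M A == 0) = (A == cl M set0).
  apply/andP/eqP => [[fA /eqP rA]|->]; last by rewrite flat_cl rk_cl rk0.
  apply/esym/(flat_rk_eq (M := M)); rewrite ?flat_cl ?cl_sub ?sub0set //.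
  by rewrite rA.
have gE C : good_chain (k := 0) C = (C == [ffun=> cl M set0]) && (#|cl M set0| == s 0).
  apply/andP/andP => [[/forallP g _]|[/eqP -> c]]; last first.
    split; last by apply/'forall_'forall_implyP=> i j; rewrite !ord1.
    by apply/forallP=> i; rewrite ord1 ffunE /good flat_cl rk_cl rk0 /= c.
  have /and3P[f r c] := g ord0.
  have e : C ord0 = cl M set0 by apply/eqP; rewrite -fl f r.
  by split; [apply/eqP/ffunP=> i; rewrite ord1 ffunE|rewrite -e].
case: eqP gE => [_|_] gE.
  by rewrite [RHS]/= -[RHS](cards1 [ffun i : 'I_1 => cl M set0]); apply: eq_card => C; rewrite !inE gE andbT.
by apply/eqP; rewrite cards_eq0; apply/eqP/setP=> C; rewrite !inE gE andbF.
Qed.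

(** The one-step bounds multiplied together. Truncated subtraction does no harm: where [s] fails to
    increase there are no good covers. *)
Lemma chain_count_bound k :
  chain_count M k s * \prod_(i < k) (s i.+1 - s i) <= \prod_(i < k) (#|T| - s i).
Proof.
elim: k => [|k IHk]; first by rewrite !big_ord0 chain_count0 muln1 leq_b1.
rewrite !big_ord_recr /= [_ * (_ - _)]mulnC mulnA.
apply: leq_trans (leq_mul (chain_count_step_le k) (leqnn _)) _.
by rewrite mulnAC leq_mul.
Qed.

(** All factors on the right are positive, so equality of the products forces equality at each step.
    A flat of rank [k.+1] contains a flat of rank [k], which ends a good chain by induction, and the
    equality case extends that chain. In particular every flat has the prescribed size. *)
Lemma chain_count_eq r :
  (forall i, i < r -> 0 < #|T| - s i) ->
  chain_count M r s * \prod_(i < r) (s i.+1 - s i) = \prod_(i < r) (#|T| - s i) ->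
  forall k A, k <= r -> flat M A -> rk M A = k -> exists2 C, good_chain (k := k) C & C ord_max = A.
Proof.
move=> pos.
elim: r pos => [|r IHr] pos e k A lek fA rA.
  move: lek rA; rewrite leqn0 => /eqP -> rA {k}.
  move: e; rewrite !big_ord0 muln1 chain_count0; case: eqP => // c _.
  exists [ffun=> A]; last by rewrite ffunE.
  rewrite /good_chain; apply/andP; split; last by apply/'forall_'forall_implyP=> i j; rewrite !ord1.
  apply/forallP=> i; rewrite ord1 ffunE /good fA rA eqxx /= -c.
  suff -> : A = cl M set0 by [].
  by apply/esym/(flat_rk_eq (M := M)); rewrite ?flat_cl ?cl_sub ?sub0set // rA.
have posr i : i < r -> 0 < #|T| - s i by move=> ir; apply: pos; apply: leqW.
have prod_pos : 0 < \prod_(i < r) (#|T| - s i) by rewrite prodn_cond_gt0 // => i _; apply: posr.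
have lt1 := chain_count_step_le r; have lt2 := chain_count_bound r.
move: e; rewrite !big_ord_recr /= [_ * (s r.+1 - _)]mulnC mulnA => e.
have posT : 0 < #|T| - s r by apply: pos.
(* The step bound and the bound for [r] are both tight, since otherwise their product would be
   strict; cancelling the last factor shows it for [r]. *)
have e2 : chain_count M r s * \prod_(i < r) (s i.+1 - s i) = \prod_(i < r) (#|T| - s i).
  apply/eqP; rewrite eqn_leq lt2 /= -(leq_pmul2r posT) -e [leqRHS]mulnAC leq_mul2r lt1 orbT //.
have pos2 : 0 < \prod_(i < r) (s i.+1 - s i).
  by rewrite lt0n; apply/eqP=> z; move: prod_pos; rewrite -e2 z muln0.
have e1 : chain_count M r.+1 s * (s r.+1 - s r) = chain_count M r s * (#|T| - s r).
  by apply/eqP; rewrite -(eqn_pmul2r pos2) e -e2 mulnAC.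
have := lek; rewrite leq_eqVlt ltnS => /predU1P[kr|lekr]; last exact: IHr posr e2 _ _ lekr fA rA.
rewrite kr in rA *; have [B fB [sB rB]] := exists_flat_below fA (ltac:(by rewrite rA) : r <= rk M A).
have [C gC eC] := IHr posr e2 r B (leqnn _) fB rB.
exists (chain_snoc C A); last by rewrite chain_snoc_max.
rewrite chain_snoc_good gC inE eC /good fA rA eqxx (chain_count_step_eq e1 gC fA rA) ?eC // eqxx /=.
by rewrite properEneq sB andbT; apply/eqP=> AB; move: rB; rewrite AB rA; lia.
Qed.

(** In a design every cover is good, so each one-step bound is an equality. *)
Lemma pmd_chain_count r : perfect_matroid_design M r s ->
  chain_count M r s * \prod_(i < r) (s i.+1 - s i) = \prod_(i < r) (#|T| - s i).
Proof.
case=> rM sz; have: r <= rank M by rewrite rM.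
elim: r {rM} => [|k IHk] ler.
  by rewrite !big_ord0 chain_count0 muln1 sz ?flat_cl // rk_cl rk0 eqxx.
rewrite !big_ord_recr /= -(IHk (ltnW ler)) [_ * (s k.+1 - _)]mulnC mulnA [RHS]mulnAC; congr (_ * _).
rewrite chain_count_step big_distrl /= chain_countE -sum1dep_card big_distrl /=.
apply: eq_bigr => C /andP[/forallP gC _]; rewrite mul1n.
have /and3P[fA /eqP rA /eqP cA] := gC ord_max.
rewrite (good_covers_card (gC ord_max)).
set A := C ord_max in fA rA cA *.
have -> : #|T| - s k = #|~: A| by rewrite -cA [RHS]cardsCs setCK.
congr #|pred_of_set _|; apply/eqP; rewrite eqEsubset good_covers_sub /=.
apply/subsetP=> x; rewrite inE => xA; apply/bigcupP; exists (cl M (x |: A)); last first.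
  by rewrite inE xA in_cl_U1.
rewrite inE /good flat_cl rk_clU1 // rA eqxx sz ?flat_cl // rk_clU1 // rA eqxx /=.
by apply/properP; rewrite sub_cl_U1; split=> //; exists x; rewrite ?in_cl_U1.
Qed.

End ChainBound.

(** * Perfect matroid designs as maximizers *)

Section PMD.

Lemma pmd_lt (T : finType) (M : matroid T) r s i j :
  perfect_matroid_design M r s -> i < j -> j <= r -> s i < s j.
Proof.
case=> rM sz ij jr.
have [B fB [_ rB]] := exists_flat_below (flatT M) (ltac:(by rewrite rk_setT rM) : j <= rk M setT).
have [A fA [sA rA]] := exists_flat_below fB (ltac:(by rewrite rB ltnW) : i <= rk M B).
rewrite -rA -rB -!sz //; apply: proper_card; rewrite properEneq sA andbT.
by apply/eqP=> e; move: ij; rewrite -rA -rB e ltnn.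
Qed.

Lemma pmd_card (T : finType) (M : matroid T) r s :
  perfect_matroid_design M r s -> #|T| = s r.
Proof. by case=> rM sz; rewrite -cardsT sz ?flatT // rk_setT rM. Qed.

(** Both counts are compared with the same product; the factor to be cancelled is positive because
    the sizes of the flats of [M0] increase strictly. *)
Lemma chain_count_max_pmd (T0 T : finType) (M0 : matroid T0) (M : matroid T) r s :
  perfect_matroid_design M0 r s -> rank M = r -> #|T| = s r ->
  chain_count M r s <= chain_count M0 r s /\
  (chain_count M r s = chain_count M0 r s <-> perfect_matroid_design M r s).
Proof.
move=> p0 rM cT.
have pos : 0 < \prod_(i < r) (s i.+1 - s i).
  by rewrite prodn_cond_gt0 // => i _; rewrite subn_gt0 (pmd_lt p0).
have b := chain_count_bound M s r; have e0 := pmd_chain_count p0.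
rewrite (pmd_card p0) -cT in e0.
split; first by rewrite -(leq_pmul2r pos) e0.
split=> [e|p]; last by apply/eqP; rewrite -(eqn_pmul2r pos) e0 (pmd_chain_count p).
split=> // A fA; rewrite -e in e0.
have posT i : i < r -> 0 < #|T| - s i.
  by move=> ir; rewrite cT subn_gt0 (pmd_lt p0).
have ler : rk M A <= r by rewrite -rM; apply: rkS (subsetT A).
have [C /andP[/forallP/(_ ord_max)/and3P[_ _ /eqP gC] _] eC] := chain_count_eq posT e0 ler fA erefl.
by rewrite -{1}eC gC.
Qed.

End PMD.

Lemma pmd_iff_maximizes r s (T0 : finType) (M0 : matroid T0) (T : finType) (M : matroid T) :
  perfect_matroid_design M0 r s ->
  perfect_matroid_design M r s <->
  maximizes (fun U (N : matroid U) => chain_count N r s) (rank_size_class r (s r)) M.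
Proof.
move=> p0; split=> [p|[[rM cT] mx]].
  split; first by split; [case: p|apply: pmd_card p].
  by move=> U N [rN cU]; have [] := chain_count_max_pmd p rN cU.
have [le <-] := chain_count_max_pmd p0 rM cT; apply/eqP; rewrite eqn_leq le /=.
by apply: mx; split; [case: p0|apply: pmd_card p0].
Qed.

(** * Dilatations of affine geometries *)

(** [E] is the set of points and [D] the set of directions, the points at infinity. [delta a b] is
    the direction of the line [a b], of no significance when [a = b]; [ln u v] is the line at
    infinity through [u] and [v]. [delta_tri] says that the sides of a triangle have collinear
    directions, and [delta_meet] that lines of different directions in one plane meet. [ln_dim] says
    that the dimension is at least 3. *)
Record affine_geometry (E D : finType) (delta : E -> E -> D)
    (ln : D -> D -> {set D}) : Prop := AffineGeometry {
  deltaC : forall a b, delta a b = delta b a;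
  ln_id : forall u, ln u u = [set u];
  mem_ln : forall u v, u \in ln u v;
  lnC : forall u v, ln u v = ln v u;
  ln_eq : forall u v w, w \in ln u v -> w != u -> ln u w = ln u v;
  delta_tri : forall a b c, a != b -> b != c -> a != c ->
    delta a c \in ln (delta a b) (delta b c);
  delta_meet : forall v w a b, v != w -> a != b -> delta a b \in ln v w ->
    exists c, (a = c \/ delta a c = v) /\ (b = c \/ delta b c = w);
  delta_ex : forall a u, exists2 b, a != b & delta a b = u;
  ln_dim : forall u v, exists w, w \notin ln u v }.

Section Affine.
Variables (E D : finType) (delta : E -> E -> D) (ln : D -> D -> {set D}).
Hypothesis ag : affine_geometry delta ln.
Implicit Types (a b c x y z : E) (u v w : D) (S : {set D}).

Let dC := deltaC ag.

(** For closed [S] this is membership of [x] in the subspace through [a] with directions [S]: a line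
    for [[set u]], a plane for [ln u v] with [u != v]. *)
Definition on S a x := (a == x) || (delta a x \in S).

Definition closed_dirs S := forall u v, u \in S -> v \in S -> ln u v \subset S.

Lemma mem_ln_r u v : v \in ln u v.
Proof. by rewrite (lnC ag) (mem_ln ag). Qed.

Lemma ln_closed u v : closed_dirs (ln u v).
Proof.
move=> x y xL yL; have [->|nxy] := eqVneq x y; first by rewrite (ln_id ag) sub1set.
have [xu|nxu] := eqVneq x u; first by rewrite xu (ln_eq ag yL) // -xu eq_sym.
rewrite -(ln_eq ag xL nxu) (lnC ag u x) in yL *.
by rewrite (ln_eq ag yL) // eq_sym.
Qed.

Lemma set1_closed u : closed_dirs [set u].
Proof. by rewrite -(ln_id ag); apply: ln_closed. Qed.

Lemma on_refl S a : on S a a.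
Proof. by rewrite /on eqxx. Qed.

Lemma onC S a b : on S a b = on S b a.
Proof. by rewrite /on eq_sym dC. Qed.

Lemma on_trans S a b c : closed_dirs S -> on S a b -> on S b c -> on S a c.
Proof.
move=> cS; rewrite /on; have [-> //|nab] := eqVneq a b.
have [-> /= ->|nbc /=] := eqVneq b c; first by rewrite orbT.
have [//|nac /= aS bS] := eqVneq a c.
exact: (subsetP (cS _ _ aS bS)) (delta_tri ag nab nbc nac).
Qed.

Lemma on_sub S S' a b : S \subset S' -> on S a b -> on S' a b.
Proof. by move=> /subsetP s /predU1P[->|/s]; rewrite /on ?eqxx // orbC => ->. Qed.

Lemma on_ln u v w a b : u \in ln v w -> on [set u] a b -> on (ln v w) a b.
Proof. by move=> uL; apply: on_sub; rewrite sub1set. Qed.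

Lemma on1_trans u a b c : on [set u] a b -> on [set u] b c -> on [set u] a c.
Proof. exact/on_trans/set1_closed. Qed.

Lemma on_delta a b : on [set delta a b] a b.
Proof. by rewrite /on set11 orbT. Qed.

Lemma on1P u a b : a != b -> on [set u] a b -> delta a b = u.
Proof. by move=> /negPf nab; rewrite /on nab inE => /eqP. Qed.

Lemma on1_uniq u v a b : u != v -> on [set u] a b -> on [set v] a b -> a = b.
Proof.
move=> nuv; rewrite /on !inE; case: eqVneq => //= _ /eqP du /eqP dv.
by rewrite -du -dv eqxx in nuv.
Qed.

Lemma on_inter u v w a b : ln u v <> ln u w ->
  on (ln u v) a b -> on (ln u w) a b -> on [set u] a b.
Proof.
move=> ne; rewrite /on inE; case: eqVneq => //= _ dv dw.
by apply: contra_notT ne => nd; rewrite -(ln_eq ag dv nd) (ln_eq ag dw nd).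
Qed.

Lemma on_meet v w a b : v != w -> on (ln v w) a b ->
  exists2 c, on [set v] a c & on [set w] b c.
Proof.
move=> nvw; rewrite /on; have [-> _|nab /= dab] := eqVneq a b.
  by exists b; rewrite eqxx.
by have [c [h1 h2]] := delta_meet ag nvw nab dab; exists c; rewrite !inE;
  [case: h1|case: h2] => ->; rewrite eqxx ?orbT.
Qed.

Section Center.

(* A centre is encoded by its star of lines: [rho x] is the direction of the
   line joining [x] to the centre. For a centre at infinity [X] is everything and
   [rho] is constant, for an ordinary centre [o] it is [rho x = delta o x] and
   [X] omits [o]. Both cases of Desargues are thus handled at once. *)
Variables (X : {set E}) (rho : E -> D).
Hypothesis rho_plane : forall x y, x \in X -> y \in X -> x != y ->
  rho y \in ln (rho x) (delta x y).
Hypothesis rho_out : forall x y, x \in X -> y \notin X -> delta x y = rho x.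

(** [ray x y] says that [y] lies on the line joining [x] to the centre; [pl x y] is the line at
    infinity of the plane through the centre, [x] and [y]. *)
Let ray x y := on [set rho x] x y.
Let pl x y := ln (rho x) (delta x y).

Lemma ray_rho x y : x \in X -> y \in X -> ray x y -> rho y = rho x.
Proof.
move=> xX yX; rewrite /ray; have [-> //|nxy /(on1P nxy) d] := eqVneq x y.
by have := rho_plane xX yX nxy; rewrite d (ln_id ag) inE => /eqP.
Qed.

Lemma rayC x y : x \in X -> y \in X -> ray x y = ray y x.
Proof.
by move=> xX yX; apply/idP/idP=> r; rewrite /ray onC ?(ray_rho xX yX r) // (ray_rho yX xX r).
Qed.

Lemma ray_trans x y z : x \in X -> y \in X -> ray x y -> ray y z -> ray x z.
Proof. by move=> xX yX r; rewrite /ray (ray_rho xX yX r); apply: on1_trans. Qed.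

Lemma nrayC x y : x \in X -> y \in X -> ~~ ray x y -> ~~ ray y x.
Proof. by move=> xX yX; rewrite rayC. Qed.

Lemma nray_trans x y z : x \in X -> y \in X -> ray x y -> ~~ ray x z -> ~~ ray y z.
Proof. by move=> xX yX rxy; apply/contra/ray_trans. Qed.

Lemma nray_neq x y : ~~ ray x y -> x != y.
Proof. by apply: contraNneq => ->; rewrite /ray on_refl. Qed.

Lemma nray_l x y : ~~ ray x y -> delta x y != rho x.
Proof. by apply: contraNneq => e; rewrite /ray -e on_delta. Qed.

Lemma nray_r x y : x \in X -> y \in X -> ~~ ray x y -> delta x y != rho y.
Proof. by move=> xX yX; rewrite rayC // dC; apply: nray_l. Qed.

Lemma plC x y : x \in X -> y \in X -> ~~ ray x y -> pl x y = pl y x.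
Proof.
move=> xX yX r; have := rho_plane xX yX (nray_neq r).
rewrite /pl (lnC ag) => /(ln_eq ag); rewrite eq_sym nray_r // => /(_ isT) <-.
by rewrite (lnC ag) dC.
Qed.

Lemma pl_eq x y z : ~~ ray x z -> on (pl x y) x z -> pl x z = pl x y.
Proof.
move=> r; rewrite /on (negPf (nray_neq r)) => /(ln_eq ag) e.
by apply: e; apply: nray_l.
Qed.

Lemma pl_perm x y z : x \in X -> y \in X -> z \in X ->
  ~~ ray x y -> ~~ ray x z -> ~~ ray y z -> pl x y = pl x z -> pl y x = pl y z.
Proof.
move=> xX yX zX rxy rxz ryz e; apply/esym/pl_eq => //; rewrite -plC //.
apply: on_trans (_ : on _ y x) _; first exact: ln_closed.
  by apply: on_ln (mem_ln_r _ _) _; rewrite onC on_delta.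
by rewrite e; apply: on_ln (mem_ln_r _ _) (on_delta _ _).
Qed.

Lemma nc_ray x y z : x \in X -> y \in X -> z \in X ->
  ~~ ray x y -> ~~ ray x z -> pl x z <> pl x y -> ~~ ray y z.
Proof.
move=> xX yX zX rxy rxz; apply: contra_notN => r; apply: pl_eq => //.
apply: on_trans (on_ln (mem_ln_r _ _) (on_delta _ _)) _; first exact: ln_closed.
by rewrite -/(pl x y) plC //; apply: on_ln (mem_ln ag _ _) r.
Qed.

(** The image is the meet of the ray of [x] with the parallel to [a x] through [b]. A meet outside
    [X] would be joined to [b] by the ray of [b] as well, hence equal [b], which lies in [X]. *)
Lemma image_exists a b x : a \in X -> b \in X -> x \in X -> ray a b -> ~~ ray a x ->
  exists y, [/\ y \in X, ray x y & on [set delta a x] b y].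
Proof.
move=> aX bX xX rab rax.
have [||y rxy yb] := @on_meet (rho x) (delta a x) x b.
- by rewrite eq_sym nray_r.
- rewrite [delta a x]dC -/(pl x a) -plC //; apply: on_trans (_ : on _ x a) _.
  + exact: ln_closed.
  + by apply: on_ln (mem_ln_r _ _) _; rewrite onC on_delta.
  + exact: on_ln (mem_ln ag _ _) rab.
exists y; split=> //; apply: contraT => yX.
have e : b = y.
  apply: on1_uniq (nray_l rax) _ _ => //.
  by rewrite -(ray_rho aX bX rab) -(rho_out bX yX) on_delta.
by rewrite -e bX in yX.
Qed.

(* The third side of the image triangle is parallel because it lies in the
   planes spanned by the rays, which meet in the ray through [e]. *)
Lemma desargues_noncoplanar a b c d e e' :
  a \in X -> c \in X -> e \in X ->
  ~~ ray a c -> ~~ ray a e -> ~~ ray c e -> pl a c <> pl a e ->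
  ray a b -> ray c d -> ray e e' ->
  on [set delta a c] b d -> on [set delta a e] b e' -> on [set delta c e] d e'.
Proof.
move=> aX cX eX rac rae rce nc rab rcd ree bd be.
have nec : e != c by rewrite eq_sym nray_neq.
have nd : delta a e != delta c e.
  apply: contra_notN nc => /eqP de.
  have := delta_tri ag (nray_neq rae) nec (nray_neq rac).
  by rewrite [delta e c]dC -de (ln_id ag) inE /pl => /eqP ->.
(* [f] is where the vertex [e'] should be: the meet of the parallels through [b] and [d]. It turns
   out to lie on the ray of [e], which identifies it with [e']. *)
have [||f bf df] := @on_meet (delta a e) (delta c e) b d => //.
  apply: on_ln bd; rewrite [delta c e]dC; exact: (delta_tri ag) (nray_neq rae) nec (nray_neq rac).
have h1 : on (pl e a) e f.
  apply: on_trans (_ : on _ e a) _; first exact: ln_closed.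
    exact: on_ln (mem_ln_r _ _) (on_delta _ _).
  rewrite -plC //; apply: on_trans (on_ln (mem_ln ag _ _) rab) _; first exact: ln_closed.
  exact: on_ln (mem_ln_r _ _) bf.
have h2 : on (pl e c) e f.
  apply: on_trans (_ : on _ e c) _; first exact: ln_closed.
    exact: on_ln (mem_ln_r _ _) (on_delta _ _).
  rewrite -plC //; apply: on_trans (on_ln (mem_ln ag _ _) rcd) _; first exact: ln_closed.
  exact: on_ln (mem_ln_r _ _) df.
have ef : on [set rho e] e f.
  apply: (on_inter _ h1 h2) => ee; apply: nc.
  by apply/esym/(pl_perm eX aX cX) => //; apply: nrayC.
suff -> : e' = f by [].
apply: (on1_uniq (nray_r aX eX rae)).
  by apply: on1_trans bf; rewrite onC.
by apply: on1_trans ef; rewrite onC.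
Qed.

Lemma exists_noncoplanar a c : a \in X -> c \in X -> ~~ ray a c ->
  exists f, [/\ f \in X, ~~ ray a f & pl a f <> pl a c].
Proof.
move=> aX cX rac; have [w wP] := ln_dim ag (rho a) (delta a c).
have [f naf daf] := delta_ex ag a w; exists f.
have nw : w != rho a by apply: contraNneq wP => ->; apply: (mem_ln ag).
split.
- by apply: contraT => /(rho_out aX) e; rewrite -daf e eqxx in nw.
- by rewrite /ray /on (negPf naf) daf inE.
- by move=> e; move: wP; rewrite -/(pl a c) -e -daf mem_ln_r.
Qed.

(** When the triangle lies in one plane with the centre, an auxiliary point [f] off that plane
    reduces the claim to three noncoplanar instances, two of which place the image of [f]
    correctly. *)
Lemma desargues a b c d e e' :
  a \in X -> b \in X -> c \in X -> e \in X ->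
  ~~ ray a c -> ~~ ray a e -> ~~ ray c e ->
  ray a b -> ray c d -> ray e e' ->
  on [set delta a c] b d -> on [set delta a e] b e' -> on [set delta c e] d e'.
Proof.
move=> aX bX cX eX rac rae rce rab rcd ree bd be.
have [co|/eqP nc] := eqVneq (pl a c) (pl a e); last first.
  exact: (@desargues_noncoplanar a b).
have [f [fX raf nf]] := exists_noncoplanar aX cX rac.
have rcf := nc_ray aX cX fX rac raf nf; have nfe := nf; rewrite co in nfe.
have ref := nc_ray aX eX fX rae raf nfe.
have [f' [f'X rff bf]] := image_exists aX bX fX rab raf.
have rfc := nrayC cX fX rcf; have rfe := nrayC eX fX ref.
have fd : on [set delta f c] f' d by apply: (@desargues_noncoplanar a b f f' c d).
have fe : on [set delta f e] f' e' by apply: (@desargues_noncoplanar a b f f' e e').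
apply: (@desargues_noncoplanar f f' c d e e') => // h.
apply/nf/esym/(pl_perm cX aX fX) => //; first exact: nrayC.
rewrite (pl_perm fX cX eX rfc rfe rce h); exact: (pl_perm aX cX eX).
Qed.

(** Points off the ray of [a] are mapped by means of the pair [a], [b], points on that ray by means
    of a second pair [c], [d]; Desargues reconciles the two recipes. Outside [X] the map is
    arbitrary. *)
Lemma central_dilatation a b : a \in X -> b \in X -> ray a b ->
  (exists2 c, c \in X & ~~ ray a c) ->
  exists2 h : E -> E, h a = b & forall x, x \in X ->
    [/\ h x \in X, ray x (h x) & forall y, y \in X -> x != y ->
      h x != h y /\ delta (h x) (h y) = delta x y].
Proof.
move=> aX bX rab [c cX rac].
have [d [dX rcd bd]] := image_exists aX bX cX rab rac.
pose P x y := x \in X -> [/\ y \in X, ray x y &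
  if ray a x then on [set delta c x] d y else on [set delta a x] b y].
have /fin_all_exists[h hP] x : exists y, P x y.
  rewrite /P; have [xX|_] := boolP (x \in X); last by exists x.
  case: (boolP (ray a x)) => rax; last first.
    by have [y ?] := image_exists aX bX xX rab rax; exists y.
  have [y ?] := image_exists cX dX xX rcd (nrayC xX cX (nray_trans aX xX rax rac)).
  by exists y.
have mixed x y : x \in X -> y \in X -> ray a x -> ~~ ray a y ->
    on [set delta x y] (h x) (h y).
  move=> xX yX rax ray'; have [hxX rhx hx] := hP x xX; have [hyX rhy hy] := hP y yX.
  rewrite rax in hx; rewrite (negPf ray') in hy.
  have rcx : ~~ ray c x := nrayC xX cX (nray_trans aX xX rax rac).
  have rxy : ~~ ray x y := nray_trans aX xX rax ray'.
  have [rcy|rcy] := boolP (ray c y); last first.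
    apply: (@desargues c d x (h x) y (h y)) => //.
    exact: (@desargues a b c d y (h y)).
  (* Here [x] is on the ray of [a] and [y] on that of [c], so neither pair serves both points. A
     third pair [g], [g'] off the plane of the two rays does. *)
  have [g [gX rag ng]] := exists_noncoplanar aX cX rac.
  have rcg := nc_ray aX cX gX rac rag ng.
  have [g' [g'X rgg bg]] := image_exists aX bX gX rab rag.
  have dg : on [set delta c g] d g' by apply: (@desargues a b c d g g').
  have rgx : ~~ ray g x := nrayC xX gX (nray_trans aX xX rax rag).
  have rgy : ~~ ray g y := nrayC yX gX (nray_trans cX yX rcy rcg).
  have gx : on [set delta g x] g' (h x) by apply: (@desargues c d g g' x (h x)).
  have gy : on [set delta g y] g' (h y) by apply: (@desargues a b g g' y (h y)).
  exact: (@desargues g g' x (h x) y (h y)).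
have far x y : x \in X -> y \in X -> ~~ ray x y -> on [set delta x y] (h x) (h y).
  move=> xX yX rxy; have [rax|rax] := boolP (ray a x); have [ray'|ray'] := boolP (ray a y).
  - by case/negP: rxy; apply: (ray_trans xX aX) ray'; rewrite rayC.
  - exact: mixed.
  - by rewrite onC dC; apply: mixed.
  move: (hP x xX) (hP y yX); rewrite (negPf rax) (negPf ray') => -[_ rx hx] [_ ry hy]; exact: (@desargues a b x (h x) y (h y)).
have hX x : x \in X -> h x \in X by case/hP.
have rh x : x \in X -> ray x (h x) by case/hP.
have far_neq x y : x \in X -> y \in X -> ~~ ray x y -> h x != h y.
  move=> xX yX; apply: contraNneq => e; apply: (ray_trans xX (hX x xX) (rh x xX)).
  by rewrite rayC ?hX // e rh.
exists h.
  have [haX raha] := hP a aX; rewrite /ray on_refl [delta c a]dC => da.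
  apply: (on1_uniq (nray_l rac)); rewrite onC; first exact: on1_trans bd da.
  by apply: on1_trans raha; rewrite onC.
move=> x xX; split=> [||y yX nxy]; [exact: hX|exact: rh|].
have [rxy|rxy] := boolP (ray x y); last first.
  have := far x y xX yX rxy; have nh := far_neq x y xX yX rxy.
  by move/(on1P nh) => ->.
(* On a common ray injectivity needs a point [g] off it: if [h x = h y], then [h g] lies on two
   lines through this point with different directions, so [h g = h x], which [far_neq] excludes. *)
have nh : h x != h y.
  have [g gX rxg] : exists2 g, g \in X & ~~ ray x g.
    have [rax|rax] := boolP (ray a x).
      by exists c => //; apply: nray_trans rac.
    by exists a; rewrite // rayC.
  have ryg : ~~ ray y g := nray_trans xX yX rxy rxg.
  apply: contraTneq (far_neq _ _ xX gX rxg) => e; rewrite negbK.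
  apply/eqP; apply: (@on1_uniq (delta x g) (delta y g)); last by rewrite e; apply: far.
    apply: contra (rxg) => /eqP dd; rewrite /ray -(on1P nxy rxy).
    have ngy : g != y by rewrite eq_sym (nray_neq ryg).
    have := delta_tri ag (nray_neq rxg) ngy nxy.
    by rewrite [delta g y]dC dd (ln_id ag) inE => /eqP ->; rewrite -dd on_delta.
  exact: far.
split=> //; rewrite (on1P nxy rxy).
apply: (on1P nh); apply: on1_trans (_ : on _ x _) .
  by rewrite onC; apply: rh.
by apply: (on1_trans rxy); rewrite -(ray_rho xX yX rxy); apply: rh.
Qed.

End Center.

(** * Translations and homotheties *)

Definition dilatation (h : E -> E) :=
  forall x y, x != y -> h x != h y /\ delta (h x) (h y) = delta x y.

(** The direction is a witness and not an invariant: the identity is a translation along every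
    [u]. *)
Definition translation u (h : E -> E) := dilatation h /\ forall x, on [set u] x (h x).

Lemma exists_delta_neq x u : exists2 y, x != y & delta x y != u.
Proof.
have [w wu] := ln_dim ag u u; rewrite (ln_id ag) inE in wu.
by have [y nxy e] := delta_ex ag x w; exists y; rewrite // e.
Qed.

Lemma exists_translation u a b : on [set u] a b ->
  exists2 h, h a = b & translation u h.
Proof.
move=> ab; have [||||||h ha hP] := @central_dilatation [set: E] (fun=> u) _ _ a b; rewrite ?inE //.
- by move=> *; apply: (mem_ln ag).
- by move=> x y _; rewrite inE.
- by have [y nay d] := exists_delta_neq a u; exists y; rewrite // /on negb_or nay inE.
exists h => //; split=> [x y nxy|x]; have [//|_ r hd] := hP x; first exact: hd.
exact: r.
Qed.

Lemma exists_homothety o a b : a != o -> b != o -> delta o a = delta o b ->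
  exists h, [/\ h o = o, h a = b & dilatation h].
Proof.
move=> ao bo oab.
have [||||||h ha hP] := @central_dilatation [set~ o] (delta o) _ _ a b.
- move=> x y; rewrite !inE ![_ == o]eq_sym => ox oy xy; exact: delta_tri.
- by move=> x y _; rewrite !inE negbK => /eqP ->.
- by rewrite !inE.
- by rewrite !inE.
- by apply: on1_trans (_ : on _ _ o) _; [rewrite onC on_delta|rewrite oab on_delta].
- have [y noy d] := exists_delta_neq o (delta o a).
  exists y; first by rewrite !inE eq_sym.
  apply: contra d => h; have /(on1P noy) -> // : on [set delta o a] o y.
  exact: on1_trans (on_delta _ _) h.
have fixo x : x != o -> h x != o /\ delta o (h x) = delta o x.
  move=> xo; have [|] := hP x; rewrite !inE // => ho r _; split=> //.
  by apply: on1P; rewrite 1?eq_sym //; apply: on1_trans r; apply: on_delta.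
exists (fun x => if x == o then o else h x); rewrite eqxx (negPf ao); split=> // x y.
have [->|xo] := eqVneq x o; have [->|yo] := eqVneq y o.
- by rewrite eqxx.
- by rewrite eq_sym; case: (fixo y yo).
- by rewrite [delta _ o]dC [delta _ o in RHS]dC; case: (fixo x xo).
move=> nxy; have [|_ _ hd] := hP x; first by rewrite !inE.
by apply: hd; rewrite ?inE.
Qed.

(** A point off the line [p q] goes to the meet of two lines known from the images of [p] and [q];
    points of that line are reached from an auxiliary [y] off it. *)
Lemma dilatation_eq h k p q : dilatation h -> dilatation k -> p != q ->
  h p = k p -> h q = k q -> h =1 k.
Proof.
move=> dh dk npq ep eq.
have line (f g : E -> E) x z : dilatation f -> dilatation g -> f x = g x ->
    on [set delta x z] (f z) (g z).
  move=> df dg e; have [<-|nxz] := eqVneq x z; first by rewrite e on_refl.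
  have [nf ff] := df _ _ nxz; have [ng gg] := dg _ _ nxz.
  apply: (@on1_trans _ _ (f x)); first by rewrite onC -ff on_delta.
  by rewrite e -gg on_delta.
have off f g x y : dilatation f -> dilatation g -> x != y -> f x = g x -> f y = g y ->
    forall z, ~~ on [set delta x y] x z -> f z = g z.
  move=> df dg nxy ex ey z nz; apply: (@on1_uniq (delta x z) (delta y z)); try exact: line.
  have [xz|nxz] := eqVneq x z; first by rewrite xz on_refl in nz.
  apply: contra (nz) => /eqP d.
  have nzy : z != y by apply: contraNneq nz => ->; apply: on_delta.
  have := delta_tri ag nxz nzy nxy; rewrite [delta z y]dC -d (ln_id ag) inE => /eqP ->.
  exact: on_delta.
move=> z; have [zl|] := boolP (on [set delta p q] p z); last exact: off.
have [<- //|npz] := eqVneq p z.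
have [y npy dy] := exists_delta_neq p (delta p q).
have ey : h y = k y by apply: (off h k p q); rewrite // /on negb_or npy inE.
by apply: (off h k p y); rewrite // /on negb_or npz inE (on1P npz zl) eq_sym.
Qed.

(** A second point of agreement suffices. It is taken in a direction [w] other than [u] and [v], so
    that its images are located by lines of two different directions. *)
Lemma translation_eq u v h k p : translation u h -> translation v k -> h p = k p -> h =1 k.
Proof.
move=> [dh th] [dk tk] e.
have [w /andP[wu wv]] : exists w, (w != u) && (w != v).
  by have [w wl] := ln_dim ag u v; exists w; apply/andP; split; apply: contraNneq wl => ->;
    [apply: (mem_ln ag)|apply: mem_ln_r].
have [y npy dy] := delta_ex ag p w.
apply: (dilatation_eq dh dk npy e).
have [nh hh] := dh _ _ npy; have [nk kk] := dk _ _ npy.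
have hw : on [set w] (h y) (k y).
  apply: on1_trans (_ : on _ _ (h p)) _; first by rewrite onC -dy -hh on_delta.
  by rewrite e -dy -kk on_delta.
have [hp|hp] := eqVneq p (h p).
  rewrite -hp in e hh.
  have hy : h y = y.
    apply: (@on1_uniq w u) => //; last by rewrite onC.
    by apply: on1_trans (_ : on _ _ p) _; [rewrite onC -dy -hh|rewrite -dy]; apply: on_delta.
  have ky : k y = y.
    apply: (@on1_uniq w v) => //; last by rewrite onC.
    by rewrite onC -{1}hy.
  by rewrite hy ky.
have uv : u = v by rewrite -(on1P hp (th p)); rewrite e in hp *; rewrite (on1P hp (tk p)).
apply: (on1_uniq wu hw); apply: on1_trans (_ : on _ _ y) _; first by rewrite onC.
by rewrite uv.
Qed.

Lemma dilatation_comp h k : dilatation h -> dilatation k -> dilatation (h \o k).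
Proof.
by move=> dh dk x y /dk[n e]; have [n' e'] := dh _ _ n; rewrite /= n' e' e.
Qed.

(** Both sides are the fourth vertex of the parallelogram on [x], [h x] and [k x]: they are joined
    by lines of directions [u] and [v] at once. *)
Lemma translation_commute_neq u v h k x : u != v -> translation u h -> translation v k ->
  h (k x) = k (h x).
Proof.
have side u' v' h' k' : translation u' h' -> translation v' k' -> on [set v'] (h' (k' x)) (k' (h' x)).
  move=> [dh th] [dk tk]; apply: on1_trans (tk _).
  have := tk x; have [e|nx] := eqVneq x (k' x); first by move=> _; rewrite -e on_refl.
  move/(on1P nx) => <-; have [_ <-] := dh _ _ nx; by rewrite onC on_delta.
move=> uv th tk; apply: (on1_uniq uv); last exact: side th tk.
by rewrite onC; apply: side tk th.
Qed.

(** The composite is compared with the translation [t] having the same value at [p]. A second point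
    of agreement comes from a translation [s] in a direction off [ln u v], which commutes with [h],
    [k] and [t] because its direction differs from theirs. *)
Lemma translation_comp u v h k : translation u h -> translation v k ->
  exists w, translation w (h \o k).
Proof.
move=> th tk; have dhk := dilatation_comp th.1 tk.1.
have [uv|uv] := eqVneq u v.
  exists u; split=> // x; apply: on1_trans (th.2 _); rewrite uv; exact: tk.2.
have [p _|none] := pickP (@predT E); last by exists u; split=> // x; have := none x.
have pl : on (ln u v) p (h (k p)).
  apply: on_trans (on_ln (mem_ln_r _ _) (tk.2 p)) _; first exact: ln_closed.
  exact: on_ln (mem_ln ag _ _) (th.2 _).
have [w wl pw] : exists2 w, w \in ln u v & on [set w] p (h (k p)).
  move: pl; rewrite /on; have [_ _|_ /= dl] := eqVneq p (h (k p)); first by exists u; rewrite ?(mem_ln ag).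
  by exists (delta p (h (k p))) => //; rewrite inE.
have [t et tt] := exists_translation pw; exists w.
have [z zl] := ln_dim ag u v; have [y npy dy] := delta_ex ag p z.
have [s es ts] := exists_translation (ltac:(by rewrite -dy on_delta) : on [set z] p y).
have nz (x : D) : x \in ln u v -> z != x by move=> xl; apply: contraNneq zl => ->.
have e : t =1 h \o k.
  apply: (dilatation_eq tt.1 dhk npy) => //=.
  have c1 : k (s p) = s (k p) by apply/esym/(translation_commute_neq _ _ ts tk)/nz/mem_ln_r.
  have c2 : h (s (k p)) = s (h (k p)).
    exact/esym/(translation_commute_neq _ _ ts th)/nz/(mem_ln ag).
  have c3 : t (s p) = s (t p) by apply/esym/(translation_commute_neq _ _ ts tt)/nz.
  by rewrite -es c1 c2 c3 et.
have [dt tt2] := tt; split=> // x; rewrite -e; exact: tt2.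
Qed.

(** For equal directions, compose [k] with a translation [s] in another direction: [h] commutes with
    both [s] and [k \o s], so [h \o k] and [k \o h] agree at [s x]. *)
Lemma translation_commute u v h k x : translation u h -> translation v k ->
  h (k x) = k (h x).
Proof.
move=> th tk; have [uv|uv] := eqVneq u v; last exact: translation_commute_neq th tk.
rewrite -{v}uv in tk.
have [y nxy dy] := exists_delta_neq x u.
have [s es ts] := exists_translation (on_delta x y).
have [w tks] := translation_comp tk ts.
have wu : u != w.
  apply: contraNneq dy => wu; rewrite -wu in tks.
  have /(on1P nxy) -> // : on [set u] x y; rewrite -es.
  by apply: on1_trans (tks.2 x) _; rewrite onC; apply: tk.2.
have e := translation_commute_neq x wu th tks.
have e' := translation_commute_neq x (ltac:(by rewrite eq_sym) : u != delta x y) th ts.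
have [w1 t1] := translation_comp th tk; have [w2 t2] := translation_comp tk th.
apply: (translation_eq (p := s x) t1 t2).
by rewrite /= in e *; rewrite e e'.
Qed.

(** The carrier of [V] is [E] with base point [o] as zero; [t a] is the translation taking [o] to
    [a], the sum of [a] and [b] is [t a b], and [dir v] is [delta o v]. The maps of the last clause
    are the homotheties with centre [o]. *)
Lemma affine_zmod : E -> exists (V : finZmodType) (f : E -> V) (dir : V -> D),
  [/\ bijective f,
      forall x y, x != y -> delta x y = dir (f y - f x)%R,
      forall u, exists2 v, v != 0%R & dir v = u,
      forall a b : V, a != 0%R -> b != 0%R -> dir a = dir b -> a != b -> dir (a - b)%R = dir a &
      forall a b : V, a != 0%R -> b != 0%R -> dir a = dir b ->
      exists k : V -> V, [/\ k a = b, forall x y : V, k (x + y)%R = (k x + k y)%R &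
        forall x : V, x != 0%R -> k x != 0%R /\ dir (k x) = dir x]].
Proof.
move=> o.
have /fin_all_exists[t tP] a : exists h : E -> E, h o = a /\ exists u, translation u h.
  by have [h e th] := exists_translation (on_delta o a); exists h; split=> //; exists (delta o a).
have t0 a : t a o = a by case: (tP a).
have tt a : exists u, translation u (t a) by case: (tP a).
have t_uniq u h : translation u h -> h =1 t (h o).
  by move=> th; have [v tv] := tt (h o); apply: (translation_eq th tv (p := o)); rewrite t0.
have tid u : translation u id.
  by split=> [x y nxy //|x]; rewrite on_refl.
have addA : associative (fun a b => t a b).
  move=> a b c; have [u tu] := tt a; have [v tv] := tt b.
  by have [w tw] := translation_comp tu tv; have /= := t_uniq _ _ tw c; rewrite t0.
have addC : commutative (fun a b => t a b).
  move=> a b; have [u tu] := tt a; have [v tv] := tt b.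
  by have := translation_commute o tu tv; rewrite !t0.
have add0 : left_id o (fun a b => t a b).
  by move=> a; have := t_uniq _ _ (tid (delta o o)) a.
have /fin_all_exists[opp oppP] a : exists a', t a' a = o.
  have [h e th] := exists_translation (on_delta a o).
  by exists (h o); rewrite -(t_uniq _ _ th).
pose mx := GRing.isZmodule.Build E addA addC add0 oppP.
pose V : finZmodType := HB.pack E mx.
have td (a : V) : dilatation (t a) by have [u []] := tt a.
have dirE (x y : V) : x != y -> delta x y = delta o (y - x)%R.
  move=> nxy; have n : (0 : V)%R != (y - x)%R by rewrite eq_sym GRing.subr_eq0 eq_sym.
  have [_ <-] := td x _ _ n; rewrite t0; congr delta.
  have -> : t x (y - x)%R = (x + (y - x))%R :> V by [].
  by rewrite GRing.addrC GRing.subrK.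
have dirD (a b : V) : (a != 0)%R -> delta b (b + a)%R = delta o a.
  move=> na; rewrite dirE; first by rewrite GRing.addrC GRing.addKr.
  by rewrite -GRing.subr_eq0 GRing.opprD GRing.addNKr GRing.oppr_eq0.
exists V, (fun x => x : V), (fun v : V => delta o v); split.
- by exists id.
- exact: dirE.
- by move=> u; have [v nv dv] := delta_ex ag o u; exists v; rewrite // eq_sym.
- move=> a b na nb dab nab; have no : b != o :> E by [].
  rewrite -dirE 1?eq_sym // dC.
  have := delta_tri ag (ltac:(done) : a != o :> E) (ltac:(by rewrite eq_sym) : o != b :> E) nab.
  by rewrite [delta a o]dC dab (ln_id ag) inE => /eqP.
move=> a b na nb dab; have [k [ko ka dk]] := @exists_homothety o a b na nb dab.
have injk : injective k.
  by move=> x y e; apply/eqP/contraT => /dk[]; rewrite e eqxx.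
have kK := f_invF injk; have Kk := invF_f injk.
exists k; split=> // [x y|x nx]; last first.
  by have := dk x o nx; rewrite ko [delta x o]dC dC => -[? ?].
have [u tu] := tt x.
(* Conjugating a translation by the homothety [k] gives a translation; it takes [o] to [k x], and
   its value at [k y] is the additivity of [k]. *)
have th : translation u (fun z => k (t x (invF injk z))).
  split=> [z z' nz|z]; last first.
    rewrite -{1}[z]kK; set w := invF injk z.
    have := tu.2 w; have [<- _|nw /(on1P nw) <-] := eqVneq w (t x w); first exact: on_refl.
    by have [_ <-] := dk _ _ nw; apply: on_delta.
  have nw : invF injk z != invF injk z'.
    by apply: contra nz => /eqP e; rewrite -[z]kK e kK.
  have [n1 e1] := tu.1 _ _ nw; have [n2 e2] := dk _ _ n1.
  rewrite n2 e2 e1; split=> //.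
  by have [_ <-] := dk _ _ nw; rewrite !kK.
have := t_uniq _ _ th (k y); rewrite Kk => ->.
have -> : invF injk o = o by rewrite -{1}ko Kk.
by rewrite t0.
Qed.

End Affine.

(** * Coordinates *)

Section FiniteCoordinates.
Local Open Scope ring_scope.

Lemma finField_generator (F : finFieldType) :
  exists g : F, forall x, x != 0 -> exists i, x = g ^+ i.
Proof.
have /cyclicP[u uP] := field_unit_group_cyclic [set: {unit F}]%G.
exists (val u) => x nx; have ux : x \is a GRing.unit by rewrite unitfE.
have : FinRing.unit F ux \in <[u]>%g by rewrite -uP inE.
case/cycleP=> i e; exists i; rewrite -FinRing.val_unitX -e //.
Qed.

(* A generator of the multiplicative group of [F] is sent to a root in [K] of its
   minimal polynomial over the prime field, which splits in [K]. *)
Lemma finField_iso (F K : finFieldType) : #|F| = #|K| ->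
  exists h : F -> K, [/\ bijective h, h 1 = 1,
    forall x y, h (x + y) = h x + h y & forall x y, h (x * y) = h x * h y].
Proof.
move=> cFK; have [p p_pr pF] := finPcharP F.
have cF : #|F| = (p ^ logn p #|F|)%N := card_pprimeChar pF.
have pK : p \in [pchar K] by apply: card_finPcharP p_pr; rewrite -cFK; apply: cF.
pose L := pPrimeCharType pF; pose M := pPrimeCharType pK.
have [g gP] := finField_generator F.
pose iL : {rmorphism 'F_p -> L} := GRing.in_alg L.
pose iM : {rmorphism 'F_p -> M} := GRing.in_alg M.
have [m mP] : exists m : {poly 'F_p}, minPoly 1%AS (g : L) = map_poly iL m.
  by apply/polyOver1P; apply: minPolyOver.
have m_dvd (Q : {poly 'F_p}) : root (map_poly iL Q) (g : L) -> m %| Q.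
  move=> rQ; rewrite -(dvdp_map iL) -mP; apply: minPoly_dvdp rQ.
  by apply/polyOver1P; exists Q.
have m_root : root (map_poly iL m) (g : L) by rewrite -mP root_minPoly.
(* The polynomial 'X^#|F| - 'X vanishes at [g], so [m] divides it; over [K], of the same order, it
   is a product of linear factors. *)
have [r mr] : exists r : M, root (map_poly iM m) r.
  have : map_poly iM m %| 'X^#|K| - 'X.
    have -> : 'X^#|K| - 'X = map_poly iM ('X^#|F| - 'X) by rewrite rmorphB /= map_polyXn map_polyX cFK.
    rewrite dvdp_map; apply: m_dvd; rewrite rmorphB /= map_polyXn map_polyX /root !hornerE.
    by rewrite [_ ^+ _](expf_card (g : F)) subrr.
  rewrite (finField_genPoly K) => /dvdp_prod_XsubC[b].
  move=> e; have : (1 < size (map_poly iM m))%N.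
    by rewrite size_map_poly -(size_map_poly iL) -mP size_minPoly ltnS.
  rewrite (eqp_size e); case: (mask b _) e => [|r s] e; first by rewrite big_nil size_poly1.
  by move=> _; exists r; rewrite (eqp_root e) big_cons rootM root_XsubC eqxx.
have /fin_all_exists[P PP] (x : F) : exists Q : {poly 'F_p}, (map_poly iL Q).[g : L] = x.
  have [->|/gP[i ->]] := eqVneq x 0; first by exists 0; rewrite rmorph0 horner0.
  by exists 'X^i; rewrite map_polyXn hornerXn.
pose h (x : F) : K := (map_poly iM (P x)).[r].
(* Independence of the chosen polynomial: two polynomials with the same value at [g] differ by a
   multiple of [m], which vanishes at [r]. *)
have hP (Q : {poly 'F_p}) x : (map_poly iL Q).[g : L] = x -> h x = (map_poly iM Q).[r].
  move=> e; have : m %| P x - Q.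
    by apply: m_dvd; rewrite /root rmorphB hornerD hornerN PP e subrr.
  rewrite -(dvdp_map iM) => /dvdpP[c ec].
  have : root (map_poly iM (P x - Q)) r by rewrite ec rootM mr orbT.
  by rewrite /root rmorphB hornerD hornerN subr_eq0 => /eqP.
have h1 : h 1 = 1 by rewrite (hP 1) ?rmorph1 ?hornerC.
have hD x y : h (x + y) = h x + h y.
  by rewrite (hP (P x + P y)) ?rmorphD ?hornerD // !PP.
have hM x y : h (x * y) = h x * h y.
  by rewrite (hP (P x * P y)) ?rmorphM ?hornerM // !PP.
exists h; split=> //; apply: inj_card_bij; last by rewrite cFK.
move=> x y e; apply/eqP; rewrite -subr_eq0; apply: contraT => n.
have hB : h (x - y) = 0.
  by apply: (addIr (h y)); rewrite -hD subrK e add0r.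
by have /eqP := h1; rewrite -(divff n) hM hB mul0r eq_sym oner_eq0.
Qed.

(* [sc] is an [F]-vector space structure on [V], given by a bare function. *)
Lemma finite_coordinates (F : finFieldType) (V : finZmodType) (sc : F -> V -> V) n :
  (forall c x y, sc c (x + y) = sc c x + sc c y) ->
  (forall c d x, sc (c + d) x = sc c x + sc d x) ->
  (forall c d x, sc (c * d) x = sc c (sc d x)) ->
  (forall x, sc 1 x = x) -> #|V| = (#|F| ^ n)%N ->
  exists f : V -> 'rV[F]_n, [/\ bijective f,
    forall x y, f (x + y) = f x + f y & forall c x, f (sc c x) = c *: f x].
Proof.
move=> scDr scDl scA sc1 cV.
have sc0 x : sc 0 x = 0 by apply: (addIr (sc 0 x)); rewrite -scDl !add0r.
have scr0 c : sc c 0 = 0 by apply: (addIr (sc c 0)); rewrite -scDr !add0r.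
have scN c x : sc c (- x) = - sc c x.
  by apply: (addrI (sc c x)); rewrite -scDr !subrr.
(* An injective linear map into [V] is enlarged one dimension at a time: as long as [m < n],
   counting leaves a vector outside its image. At [m = n] counting makes it bijective. *)
suff: forall m, (m <= n)%N -> exists g : 'rV[F]_m -> V, [/\ injective g,
    forall x y, g (x + y) = g x + g y & forall c x, g (c *: x) = sc c (g x)].
  move/(_ n (leqnn n))=> [g [injg gD gZ]].
  have [f fK gK] : bijective g by apply: inj_card_bij; rewrite // cV card_mx mul1n.
  exists f; split; first by exists g.
    by move=> x y; apply: (can_inj fK); rewrite gD !gK.
  by move=> c x; apply: (can_inj fK); rewrite gZ !gK.
elim=> [|m IHm] lemn.
  by exists (fun=> 0); split=> [x y _|x y|c x]; rewrite ?addr0 ?scr0 // [x]thinmx0 [y]thinmx0.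
have [g [injg gD gZ]] := IHm (ltnW lemn).
have [v vP] : exists v, v \notin codom g.
  apply/existsP; rewrite -negb_forall; apply/negP=> /forallP all_in.
  have : (#|V| <= #|codom g|)%N by apply/subset_leq_card/subsetP=> x _.
  rewrite card_codom // cV card_mx mul1n leqNgt ltn_exp2l ?lemn //.
  exact: finNzRing_gt1.
have gN x : g (- x) = - g x by rewrite -scaleN1r gZ; apply: (addrI (g x));
  rewrite -{1}[g x]sc1 -scDl !subrr sc0.
pose k (x : 'rV[F]_m.+1) := sc (x 0 0) v + g (rsubmx (x : 'rV_(1 + m))).
have kD x y : k (x + y) = k x + k y.
  by rewrite /k mxE scDl linearD gD addrACA.
have kZ c x : k (c *: x) = sc c (k x) by rewrite /k mxE scA linearZ gZ scDr.
exists k; split=> // x y e.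
have kN z : k (- z) = - k z.
  by rewrite -scaleN1r kZ; apply: (addrI (k z)); rewrite -{1}[k z]sc1 -scDl !subrr sc0.
suff : x - y = 0 by move/eqP; rewrite subr_eq0 => /eqP.
have {e} : k (x - y) = 0 by rewrite kD kN e subrr.
move: (x - y) => {x y} z; rewrite /k => kz.
have z0 : z 0 0 = 0.
  apply/eqP; apply: contraT => nz; case/negP: vP.
  apply/codomP; exists (- (z 0 0)^-1 *: rsubmx (z : 'rV_(1 + m))).
  rewrite scaleNr gN gZ -scN; apply: (addIr (sc (z 0 0)^-1 (g (rsubmx (z : 'rV_(1+m)))))).
  rewrite -{1}[v]sc1 -(mulVf nz) scA -scDr kz -scDr addNr //.
have gz : rsubmx (z : 'rV_(1 + m)) = 0.
  apply: injg; move: kz; rewrite z0 sc0 add0r => ->.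
  by rewrite -(scale0r 0) gZ sc0.
apply/rowP=> i; rewrite mxE; case: (splitP (i : 'I_(1 + m))) => j e.
  by rewrite -z0; congr (z _ _); apply: val_inj; rewrite /= e [j]ord1.
have := congr1 (fun w : 'rV_m => w 0 j) gz; rewrite !mxE => <-; congr (z _ _).
exact: val_inj.
Qed.

(* The endomorphisms preserving every direction form a finite division ring,
   hence a field by Wedderburn, of the order of a line. *)
Lemma direction_coordinates (V : finZmodType) (D : eqType) (dir : V -> D)
    (F : finFieldType) n :
  (forall a, a != 0 -> dir (- a) = dir a) ->
  (forall a b, a != 0 -> b != 0 -> dir a = dir b -> a != b -> dir (a - b) = dir a) ->
  (forall a, exists2 b, b != 0 & dir b != dir a) ->
  (forall a b, a != 0 -> b != 0 -> dir a = dir b ->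
     exists k : V -> V, [/\ k a = b, forall x y, k (x + y) = k x + k y &
       forall x, x != 0 -> k x != 0 /\ dir (k x) = dir x]) ->
  (forall a, a != 0 -> #|[set x | (x == 0) || (dir x == dir a)]| = #|F|) ->
  #|V| = (#|F| ^ n)%N ->
  exists f : V -> 'rV[F]_n, [/\ bijective f, forall x y, f (x + y) = f x + f y &
    forall a b, a != 0 -> b != 0 -> dir a = dir b <-> exists c, f b = c *: f a].
Proof.
move=> dirN dirB np hom cline cV.
(* The line of 0 is the singleton of 0, so that [k x \in line x] is the right condition at every
   [x]. *)
pose line x := [set y | (y == 0) || (x != 0) && (dir y == dir x)].
have line0 x : 0 \in line x by rewrite inE eqxx.
have lineid x : x \in line x by rewrite inE eqxx; case: eqP.
have lineN x y : y \in line x -> - y \in line x.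
  by rewrite !inE oppr_eq0; case: (eqVneq y 0) => //= ny; rewrite dirN.
have lineB x y z : y \in line x -> z \in line x -> y - z \in line x.
  have [->|nyz] := eqVneq y z; first by rewrite subrr.
  rewrite !inE; have [-> _|ny /= /andP[nx /eqP dy]] := eqVneq y 0.
    rewrite sub0r oppr_eq0; case: (eqVneq z 0) => //= nz; rewrite dirN //.
  have [-> _|nz /= /andP[_ /eqP dz]] := eqVneq z 0; first by rewrite subr0 nx dy eqxx orbT.
  by rewrite nx dirB ?dz // dy eqxx orbT.
have lineD x y z : y \in line x -> z \in line x -> y + z \in line x.
  by move=> hy /lineN hz; rewrite -[z]opprK lineB.
have line_trans x y z : y \in line x -> z \in line y -> z \in line x.
  rewrite !inE; have [//|nz /=] := eqVneq z 0.
  by have [-> |ny /=] := eqVneq y 0; rewrite ?andbF // => /andP[-> /eqP <-].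
pose P (k : {ffun V -> V}) := [forall x, forall y, k (x + y) == k x + k y] &&
  [forall x, k x \in line x].
have PP (k : {ffun V -> V}) : reflect ((forall x y, k (x + y) = k x + k y) /\ (forall x, k x \in line x)) (P k).
  apply: (iffP andP) => -[h1 h2]; split.
  - by move=> x y; apply/eqP; have /forallP/(_ y) := forallP h1 x.
  - exact/forallP.
  - by apply/forallP=> x; apply/forallP=> y; rewrite h1.
  - exact/forallP.
pose K : finType := {k : {ffun V -> V} | P k}.
have KD (k : K) x y : val k (x + y) = val k x + val k y by have /PP[] := valP k.
have Kl (k : K) x : val k x \in line x by have /PP[] := valP k.
have mk (k : V -> V) : (forall x y, k (x + y) = k x + k y) -> (forall x, k x \in line x) ->
    exists m : K, forall x, val m x = k x.
  move=> h1 h2; have Pk : P [ffun x => k x].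
    by apply/PP; split=> [x y|x]; rewrite !ffunE.
  by exists (Sub [ffun x => k x] Pk) => x; rewrite SubK ffunE.
have extK (k l : K) : (forall x, val k x = val l x) -> k = l.
  by move=> e; apply/val_inj/ffunP.
have K0 (k : K) : val k 0 = 0 by apply: (addIr (val k 0)); rewrite -KD !add0r.
have [zero zeroP] : exists m : K, forall x, val m x = 0 by apply: mk => [x y|x //]; rewrite addr0.
have [one oneP] : exists m : K, forall x, val m x = x by apply: mk.
have /fin_all_exists[opp oppP] (k : K) : exists m : K, forall x, val m x = - val k x.
  by apply: mk => [x y|x]; rewrite ?KD ?opprD ?lineN.
have /fin_all_exists[add addP] (k : K) : exists f : K -> K, forall l x, val (f l) x = val k x + val l x.
  have ex (l : K) : exists m : K, forall x, val m x = val k x + val l x.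
    by apply: mk => [x y|x]; [rewrite !KD addrACA|apply: lineD].
  exact: fin_all_exists ex.
have /fin_all_exists[mul mulP] (k : K) : exists f : K -> K, forall l x, val (f l) x = val k (val l x).
  have ex (l : K) : exists m : K, forall x, val m x = val k (val l x).
    by apply: mk => [x y|x]; [rewrite !KD|apply: line_trans (Kl l x) (Kl k _)].
  exact: fin_all_exists ex.
(* If [k] kills [y] but not [z], then [k z = k (y + z)] lies on the lines of both [z] and [y + z],
   which puts [z] on the line of [y]. Points of that line are then killed by way of a vector off
   it. *)
have Kinj (k : K) x : x != 0 -> val k x = 0 -> k = zero.
  have off y z : y != 0 -> val k y = 0 -> z \notin line y -> val k z = 0.
    move=> ny ky; apply: contraNeq => nkz.
    have nz : z != 0 by apply: contraNneq nkz => ->; rewrite K0.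
    have := Kl k z; have := Kl k (y + z); rewrite KD ky add0r !inE (negPf nkz) /= nz ny /=.
    case/andP=> nyz /eqP -> /eqP e.
    have := dirB _ _ nyz nz e; rewrite addrK -{1}[z]add0r => -> //; first by rewrite e eqxx orbT.
    by rewrite add0r -subr_eq0 addrK.
  move=> nx kx; apply: extK => y; rewrite zeroP.
  have [yl|] := boolP (y \in line x); last exact: off kx.
  have [->|ny] := eqVneq y 0; first exact: K0.
  have [z nz dz] := np x.
  have zl : z \notin line x by rewrite inE (negPf nz) nx.
  apply: (off z); rewrite ?(off x z) // inE (negPf ny) nz /=.
  by move: yl; rewrite inE (negPf ny) nx /= => /eqP ->; rewrite eq_sym.
have Ksurj x y : x != 0 -> y \in line x -> exists k : K, val k x = y.
  move=> nx; rewrite inE nx /=; have [->|ny /= /eqP dy] := eqVneq y 0; first by exists zero; rewrite zeroP.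
  have [k [<- kD kl]] := hom _ _ nx ny (esym dy).
  have [//|z|m mE] := mk k; last by exists m.
  rewrite inE.
  have [->|nz] := eqVneq z 0; last by have [_ ->] := kl _ nz; rewrite eqxx orbT.
  by apply/orP; left; apply/eqP/(addIr (k 0)); rewrite -kD !add0r.
have addAK : associative add.
  by move=> k l m; apply: extK => x; rewrite !addP addrA.
have addCK : commutative add.
  by move=> k l; apply: extK => x; rewrite !addP addrC.
have add0K : left_id zero add.
  by move=> k; apply: extK => x; rewrite addP zeroP add0r.
have addNK : left_inverse zero opp add.
  by move=> k; apply: extK => x; rewrite addP oppP zeroP addNr.
have mulAK : associative mul.
  by move=> k l m; apply: extK => x; rewrite !mulP.
have mul1K : left_id one mul.
  by move=> k; apply: extK => x; rewrite mulP oneP.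
have mulr1K : right_id one mul.
  by move=> k; apply: extK => x; rewrite mulP oneP.
have mulDlK : left_distributive mul add.
  by move=> k l m; apply: extK => x; rewrite !(mulP, addP).
have mulDrK : right_distributive mul add.
  by move=> k l m; apply: extK => x; rewrite !(mulP, addP) KD.
pose zm := GRing.isZmodule.Build K
  addAK
  addCK
  add0K
  addNK.
pose KZ : finZmodType := HB.pack K zm.
have [x0 nx0 _] := np 0.
have one_neq0 : one != zero :> KZ.
  by apply: contraNneq nx0 => e; rewrite -[x0]oneP e zeroP.
pose rg := GRing.Zmodule_isNzRing.Build KZ
  mulAK
  mul1K
  mulr1K
  mulDlK
  mulDrK
  one_neq0.
pose KR : finNzRingType := HB.pack KZ rg.
pose ur := FinRing.isNzRing.Build KR.
pose KU : finUnitRingType := HB.pack KR ur.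
(* Wedderburn's theorem enters through [FinDomainFieldType], which asks only for the absence of zero
   divisors; this is [Kinj]. *)
have dom : GRing.integral_domain_axiom KU.
  move=> k l e; have [_|nl] := eqVneq l 0; [by rewrite orbT|rewrite orbF; apply/eqP].
  have [x nlx] : exists x, val (l : K) x != 0.
    apply/existsP; apply: contraNT nl; rewrite negb_exists => /forallP h.
    by apply/eqP/(extK) => x; rewrite zeroP; apply/eqP/negPn/h.
  have e' : mul k l = zero := e.
  by apply: (Kinj k _ nlx); rewrite -mulP e' zeroP.
pose KF := FinDomainFieldType dom.
(* Evaluation at [x0] is a bijection from [K] onto the line of [x0]. *)
have cK : #|F| = #|KF|.
  rewrite -(cline x0 nx0) -cardsT -(card_in_imset (f := fun k : K => val k x0)).
    apply: eq_card => y; apply/idP/imsetP => [|[k _ ->]].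
      rewrite inE => hy; have [|k <-] := Ksurj x0 y nx0; first by rewrite inE nx0.
      by exists k.
    by have := Kl k x0; rewrite !inE nx0.
  move=> k l _ _ e; have := Kinj (add k (opp l)) x0 nx0.
  rewrite addP oppP e subrr => /(_ erefl) h; apply: extK => x.
  by apply/eqP; rewrite -subr_eq0 -oppP -addP h zeroP.
have [th [thb th1 thD thM]] := finField_iso cK.
have thDx c d x : val (th (c + d) : K) x = val (th c : K) x + val (th d : K) x.
  by rewrite thD -addP.
have thMx c d x : val (th (c * d) : K) x = val (th c : K) (val (th d : K) x).
  by rewrite thM -mulP.
have th1x x : val (th 1 : K) x = x by rewrite th1 -[RHS]oneP.
have [f [fb fD fZ]] := finite_coordinates (fun c x y => KD (th c) x y) thDx thMx th1x cV.
exists f; split=> // a b na nb; split=> [dab|[c]].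
  have [|k kab] := Ksurj a b na; first by rewrite inE na dab eqxx orbT.
  by have [g _ gK] := thb; exists (g k); rewrite -fZ gK kab.
rewrite -fZ => /(bij_inj fb) e; have := Kl (th c) a.
by rewrite -e inE (negPf nb) na /= => /eqP.
Qed.

End FiniteCoordinates.

(** Equality of directions becomes proportionality of differences, which is all that is used of the
    coordinates later. The two cardinalities fix the order of the division ring and the
    dimension. *)
Lemma affine_coordinates (E D : finType) (delta : E -> E -> D) (ln : D -> D -> {set D})
    (F : finFieldType) n :
  affine_geometry delta ln ->
  (forall a u, #|[set x | on delta [set u] a x]| = #|F|) -> #|E| = #|F| ^ n ->
  exists f : E -> 'rV[F]_n, bijective f /\
    forall a b c d, a != b -> c != d ->
      delta a b = delta c d <-> exists t : F, (f d - f c = t *: (f b - f a))%R.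
Proof.
move=> ag cl cE.
have [o _] : exists o : E, o \in E.
  by apply/card_gt0P; rewrite cE expn_gt0 (ltnW (finNzRing_gt1 F)).
have [V [g [dir [gb gd dsurj dB hom]]]] := affine_zmod ag o.
have [g' gK g'K] := gb.
have inj_g := can_inj gK.
have gneq x y : x != y -> (g y - g x != 0)%R.
  by rewrite subr_eq0 (inj_eq inj_g) eq_sym.
have np (a : V) : exists2 b, b != 0%R & dir b != dir a.
  have [w] := ln_dim ag (dir a) (dir a); rewrite (ln_id ag) inE => wa.
  by have [b nb e] := dsurj w; rewrite -e in wa; exists b.
have dN (a : V) : (a != 0 -> dir (- a) = dir a)%R.
  move=> na; have n0 : g' a != g' 0%R by rewrite (inj_eq (can_inj g'K)).
  have := gd _ _ n0; rewrite !g'K sub0r => <-.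
  by rewrite (deltaC ag) gd 1?eq_sym // !g'K subr0.
have cV : #|V| = #|F| ^ n by rewrite -cE (bij_eq_card gb).
have cline (a : V) : (a != 0)%R -> #|[set x | (x == 0)%R || (dir x == dir a)]| = #|F|.
  move=> na; rewrite -(cl (g' 0%R) (dir a)) -(card_imset _ inj_g); apply: eq_card => x.
  apply/idP/imsetP => [|[y yl ->]].
    rewrite inE => h; exists (g' x); last by rewrite g'K.
    rewrite inE /on inE; have [//|nx /=] := eqVneq (g' 0%R) (g' x).
    rewrite gd // !g'K subr0; case/predU1P: h => [x0|//].
    by rewrite x0 eqxx in nx.
  move: yl; rewrite !inE /on inE; have [<-|nx /=] := eqVneq (g' 0%R) y; first by rewrite g'K eqxx.
  by rewrite gd // g'K subr0 orbC => ->.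
have [h [hb hD hdir]] := direction_coordinates dN dB np hom cline cV.
have h0 : h 0%R = 0%R by apply: (addIr (h 0%R)); rewrite -hD !add0r.
have hN x : (h (- x) = - h x)%R by apply: (addrI (h x)); rewrite -hD !subrr.
exists (h \o g); split; first exact: bij_comp.
move=> a b c d ab cd; rewrite !gd //=; have := hdir _ _ (gneq _ _ ab) (gneq _ _ cd).
by rewrite !hD !hN.
Qed.

(** * Perfect matroid designs *)

Section PMDTools.

Lemma pmd_inj (T : finType) (M : matroid T) r s i j :
  perfect_matroid_design M r s -> i <= r -> j <= r -> s i = s j -> i = j.
Proof.
move=> p ir jr e; have [ij|ij|//] := ltngtP i j.
  by have := pmd_lt p ij jr; rewrite e ltnn.
by have := pmd_lt p ij ir; rewrite e ltnn.
Qed.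

(** A flat and its image have the same size, hence the same rank. Flats need therefore be tracked in
    one direction only: by induction on an independent set, the closure of its image is the image of
    its closure. *)
Lemma pmd_isomorphic (T T' : finType) (M : matroid T) (M' : matroid T') r s (f : T -> T') :
  perfect_matroid_design M r s -> perfect_matroid_design M' r s -> bijective f ->
  (forall A, flat M A -> flat M' (f @: A)) -> isomorphic M M'.
Proof.
move=> p p' fb ff; have inj_f := bij_inj fb.
have rkle A : rk M A <= r by case: p => <- _; apply: rkS (subsetT A).
have rkle' A : rk M' A <= r by case: p' => <- _; apply: rkS (subsetT A).
have rkf A : flat M A -> rk M' (f @: A) = rk M A.
  move=> fA; apply: (pmd_inj p) => //.
  by case: p p' => _ h [_ h']; rewrite -h // -h' ?ff // card_imset.
have indep_le I : I \in indep M -> rk M' (f @: I) = #|I|.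
  have [k] := ubnP #|I|; elim: k I => // k IHk I; rewrite ltnS => leI iI.
  have [->|[x xI]] := set_0Vmem I; first by rewrite imset0 rk0 cards0.
  rewrite -(setD1K xI) cardsU1 !inE eqxx /= imsetU1; set J := I :\ x.
  have iJ : J \in indep M := indepS (subsetDl _ _) iI.
  have rJ : rk M' (f @: J) = #|J|.
    by apply: IHk iJ; move: leI; rewrite (cardsD1 x I) xI.
  have e : cl M' (f @: J) = f @: cl M J.
    apply: (@flat_rk_eq _ M'); rewrite ?ff ?flat_cl //.
      by rewrite cl_sub ?ff ?flat_cl // imsetS // sub_cl.
    by rewrite rkf ?flat_cl // !rk_cl rJ rk_indep.
  rewrite rkU1 rJ e (mem_imset _ _ inj_f) addnC; congr addn.
  rewrite (@cl_basis _ _ J J) ?rk_indep // /J setD1K // iI andbT.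
  by rewrite !inE eqxx.
have rkE (A : {set T}) : rk M' (f @: A) = rk M A.
  apply/eqP; rewrite eqn_leq -{1}(rk_cl M A) -(rkf (cl M A)) ?flat_cl // rkS ?imsetS ?sub_cl //=.
  have [I iI [sI <-]] := rk_basis M A.
  by rewrite -indep_le // rkS ?imsetS.
exists f => // A; by rewrite !indep_rk rkE card_imset.
Qed.

Variables (T : finType) (M : matroid T).
Implicit Types (A B C G Z : {set T}) (x y z : T).

Definition covers Z G := [set C | [&& flat M C, rk M C == (rk M Z).+1, Z \subset C & C \subset G]].

Lemma coversP Z G C : reflect [/\ flat M C, rk M C = (rk M Z).+1, Z \subset C & C \subset G]
  (C \in covers Z G).
Proof. by rewrite inE; apply: (iffP and4P) => -[? /eqP ? ? ?]. Qed.

Lemma covers_bigcup Z G : flat M Z -> flat M G -> Z \subset G ->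
  \bigcup_(C in covers Z G) (C :\: Z) = G :\: Z.
Proof.
move=> fZ fG sZG; apply/eqP; rewrite eqEsubset; apply/andP; split.
  by apply/bigcupsP=> C /coversP[_ _ _ sC]; apply: setSD.
apply/subsetP=> x; rewrite inE => /andP[xZ xG]; apply/bigcupP.
exists (cl M (x |: Z)); last by rewrite inE xZ in_cl_U1.
apply/coversP; rewrite flat_cl rk_clU1 // sub_cl_U1; split=> //.
by rewrite cl_sub // subUset sub1set xG.
Qed.

Lemma sum_covers Z G : flat M Z -> flat M G -> Z \subset G ->
  \sum_(C in covers Z G) #|C :\: Z| = #|G| - #|Z|.
Proof.
move=> fZ fG sZG; rewrite -card_bigcup_disjoint ?covers_bigcup // ?cardsD ?(setIidPr sZG) //.
move=> C C' /coversP[fC rC sC _] /coversP[fC' rC' sC' _] ne.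
rewrite -setI_eq0; apply: contraNT ne => /set0Pn[x].
rewrite !inE => /andP[/andP[xZ xC] /andP[_ xC']].
by rewrite (cover_cl fZ fC sC rC xC xZ) // (cover_cl fZ fC' sC' rC' xC' xZ).
Qed.

Variables (r : nat) (s : nat -> nat).
Hypothesis pmd : perfect_matroid_design M r s.

Lemma pmd_size A : flat M A -> #|A| = s (rk M A).
Proof. by case: pmd => _; apply. Qed.

(* The flats spanned by [x] and the covers of [Z] in [G] are disjoint outside the
   span of [x] and [Z]; by the size hypothesis there is no room for anything else. *)
Lemma join_cover Z G x y : let k := rk M Z in let i := rk M G in
  flat M Z -> flat M G -> Z \subset G -> x \notin G ->
  (s i - s k) * (s k.+2 - s k.+1) = (s i.+1 - s k.+1) * (s k.+1 - s k) ->
  y \in cl M (x |: G) -> y \notin cl M (x |: Z) ->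
  exists c, [/\ c \in G, c \notin Z & y \in cl M (x |: (c |: Z))].
Proof.
move=> k i fZ fG sZG xG sizes yG yW.
have xZ : x \notin Z by apply: contra xG; apply: (subsetP sZG).
set W := cl M (x |: Z) in yW.
have rW : rk M W = k.+1 by rewrite rk_clU1.
have fW : flat M W by apply: flat_cl.
pose P C := cl M (x |: C).
have PP C : C \in covers Z G ->
    [/\ rk M (P C) = k.+2, W \subset P C, P C \subset cl M (x |: G) & P C :&: G = C].
  move=> /coversP[fC rC sZC sCG].
  have xC : x \notin C by apply: contra xG; apply: (subsetP sCG).
  have rP : rk M (P C) = k.+2 by rewrite rk_clU1 // rC.
  split=> //; try by apply: clS; apply: setUS.
  apply/esym/(flat_rk_eq fC); rewrite ?flatI ?flat_cl ?subsetI ?sCG ?sub_cl_U1 //.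
  rewrite rC -ltnS -rP; apply: flat_rk_lt; first by rewrite flatI ?flat_cl.
  apply/properP; rewrite subsetIl; split=> //; exists x; first exact: in_cl_U1.
  by rewrite inE (negPf xG) andbF.
have cP C : C \in covers Z G -> #|P C :\: W| = s k.+2 - s k.+1.
  move=> /PP[rP sW _ _].
  by rewrite cardsD (setIidPr sW) !pmd_size ?flat_cl // rP rW.
have eqU : \bigcup_(C in covers Z G) (P C :\: W) = cl M (x |: G) :\: W.
  apply/eqP; rewrite eqEcard; apply/andP; split.
    by apply/bigcupsP=> C /PP[_ _ sP _]; apply: setSD.
  rewrite card_bigcup_disjoint => [|C C' CZ CZ' ne]; last first.
    rewrite -setI_eq0; apply: contraNT ne => /set0Pn[z].
    rewrite in_setI !in_setD => /andP[/andP[zW zC] /andP[_ zC']].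
    have [rP sW _ eC] := PP C CZ; have [rP' sW' _ eC'] := PP C' CZ'.
    rewrite -eC -eC'; apply/eqP; congr (_ :&: _).
    have -> : P C = cl M (z |: W) by apply: (cover_cl fW) zC zW; rewrite ?flat_cl ?rP ?rW.
    by apply/esym; apply: (cover_cl fW) zC' zW; rewrite ?flat_cl ?rP' ?rW.
  rewrite (eq_bigr _ cP) sum_nat_const.
  have sWG : W \subset cl M (x |: G) by apply: clS; apply: setUS.
  rewrite cardsD (setIidPr sWG) !pmd_size ?flat_cl // rW rk_clU1 //.
  have pos : 0 < s k.+1 - s k.
    rewrite subn_gt0; apply: (pmd_lt pmd) => //.
    by rewrite -rW; case: pmd => <- _; apply: rkS (subsetT _).
  (* Multiplied by [s k.+1 - s k], the number of covers becomes [s i - s k], and the hypothesis on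
     sizes applies. *)
  rewrite -(leq_pmul2r pos) -sizes mulnAC leq_mul2r; apply/orP; right.
  rewrite -!pmd_size // -sum_covers // -sum_nat_const; apply: eq_leq.
  apply: eq_bigr => C /coversP[fC rC sC _].
  by rewrite cardsD (setIidPr sC) !pmd_size // rC.
have : y \in cl M (x |: G) :\: W by rewrite in_setD yW.
rewrite -eqU => /bigcupP[C CZ]; rewrite in_setD => /andP[_ yC].
have /coversP[fC rC sZC sCG] := CZ.
have /subsetPn[c cC cZ] : ~~ (C \subset Z).
  by apply/negP=> /(rkS M); rewrite rC ltnn.
exists c; split=> //; first exact: (subsetP sCG).
by move: yC; rewrite /P (cover_cl fZ fC sZC rC cC cZ) cl_clU1.
Qed.

End PMDTools.

(** * Points and lines of simple designs *)

Section SimplePMD.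
Variables (T : finType) (M : matroid T) (r : nat) (s : nat -> nat).
Hypotheses (pmd : perfect_matroid_design M r s) (s0 : s 0 = 0) (s1 : s 1 = 1).
Implicit Types (A G : {set T}) (x y z : T).

Lemma cl_set0 : cl M set0 = set0.
Proof. by apply: cards0_eq; rewrite (pmd_size pmd) ?flat_cl // rk_cl rk0. Qed.

Lemma rk_set1 x : rk M [set x] = 1.
Proof. by rewrite -[[set x]]setU0 rkU1 rk0 cl_set0 inE. Qed.

Lemma cl_set1 x : cl M [set x] = [set x].
Proof.
apply/esym/eqP; rewrite eqEcard sub_cl cards1 (pmd_size pmd) ?flat_cl //.
by rewrite rk_cl rk_set1 s1.
Qed.

Lemma flat_set1 x : flat M [set x].
Proof. by apply/flatP/cl_set1. Qed.

Definition line x y := cl M [set x; y].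

Lemma lineC x y : line x y = line y x.
Proof. by rewrite /line setUC. Qed.

Lemma line_l x y : x \in line x y.
Proof. by rewrite (subsetP (sub_cl _ _)) // !inE eqxx. Qed.

Lemma line_r x y : y \in line x y.
Proof. by rewrite lineC line_l. Qed.

Lemma line_flat x y : flat M (line x y).
Proof. exact: flat_cl. Qed.

Lemma line_id x : line x x = [set x].
Proof. by rewrite /line setUid cl_set1. Qed.

Lemma rk_line x y : x != y -> rk M (line x y) = 2.
Proof. by move=> n; rewrite rk_cl rkU1 rk_set1 cl_set1 inE n. Qed.

Lemma line_sub G x y : flat M G -> x \in G -> y \in G -> line x y \subset G.
Proof. by move=> fG xG yG; rewrite cl_sub // subUset !sub1set xG. Qed.

Lemma line_eq x y u v : x != y -> u != v -> u \in line x y -> v \in line x y ->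
  line u v = line x y.
Proof.
move=> nxy nuv uL vL; apply: (flat_rk_eq (line_flat u v) (line_flat x y)).
  exact: line_sub (line_flat _ _) uL vL.
by rewrite !rk_line.
Qed.

Lemma line_eql x y z : z != x -> z \in line x y -> line x z = line x y.
Proof.
move=> nzx zL; have [xy|nxy] := eqVneq x y.
  by move: zL; rewrite -xy line_id inE (negPf nzx).
by apply: line_eq; rewrite // 1?eq_sym // line_l.
Qed.

Lemma line_exchange x y z : z != x -> z \in line x y -> y \in line x z.
Proof. by move=> n h; rewrite (line_eql n h) line_r. Qed.

Lemma pmd_simple : simple M.
Proof.
have nc A : A \in indep M -> ~~ circuit M A.
  by move=> iA; apply/negP=> /minsetP[]; rewrite iA.
split=> [x|x y nxy]; apply: nc; rewrite indep_rk; first by rewrite rk_set1 cards1.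
by rewrite rkU1 cl_set1 inE nxy rk_set1 cards2 nxy.
Qed.

End SimplePMD.

(** * Vector matroids *)

Lemma dimv_add_line (K : fieldType) (vT : vectType K) (v : vT) (U : {vspace vT}) :
  \dim (<[v]> + U) = \dim U + (v \notin U).
Proof.
have [vU|vU] := boolP (v \in U).
  by rewrite (addv_idPr _) ?addn0 // -memvE.
have nv : v != 0%R by apply: contraNneq vU => ->; rewrite mem0v.
rewrite dimv_disjoint_sum ?dim_vline ?nv 1?addnC //.
apply/eqP; rewrite -subv0; apply/subvP=> w; rewrite memv_cap => /andP[/vlineP[c ->]].
rewrite rpredZeq (negPf vU) orbF => /eqP ->.
by rewrite scale0r mem0v.
Qed.

Section VectorMatroidRank.
Variables (K : fieldType) (vT : vectType K) (T : finType) (phi : T -> vT).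
Let M := vector_matroid phi.
Implicit Types (A : {set T}).

Definition vspan A : {vspace vT} := <<[seq phi x | x <- enum A]>>%VS.

Lemma mem_vspan A x : x \in A -> phi x \in vspan A.
Proof. by move=> xA; apply/memv_span/map_f; rewrite mem_enum. Qed.

Lemma vspan_sub A (U : {vspace vT}) : (forall x, x \in A -> phi x \in U) -> (vspan A <= U)%VS.
Proof. by move=> h; apply/span_subvP=> v /mapP[x]; rewrite mem_enum => /h ? ->. Qed.

Lemma vspanU1 x A : vspan (x |: A) = (<[phi x]> + vspan A)%VS.
Proof.
apply/eqP; rewrite eqEsubv; apply/andP; split.
  apply: vspan_sub => y; rewrite !inE => /predU1P[->|yA].
    by rewrite (subvP (addvSl _ _)) ?memv_line.
  by rewrite (subvP (addvSr _ _)) ?mem_vspan.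
rewrite subv_add -memvE mem_vspan ?setU11 //=.
by apply: vspan_sub => y yA; rewrite mem_vspan // inE yA orbT.
Qed.

Lemma vector_indepE A : (A \in indep M) = (\dim (vspan A) == #|A|).
Proof. by rewrite inE /free size_map -cardE. Qed.

Lemma vector_rk A : rk M A = \dim (vspan A).
Proof.
have [I iI [sI eI]] := rk_basis M A.
have dI : \dim (vspan I) = #|I| by apply/eqP; rewrite -vector_indepE.
rewrite -eI -dI; apply/eqP; rewrite eqn_leq; apply/andP; split.
  by apply/dimvS/vspan_sub => x xI; rewrite mem_vspan // (subsetP sI).
apply/dimvS/vspan_sub => x xA; apply: contraT => xI.
have xnI : x \notin I by apply: contra xI => xI; rewrite mem_vspan.
have iX : x |: I \in indep M.
  by rewrite vector_indepE vspanU1 dimv_add_line xI cardsU1 xnI dI addnC.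
have := indep_le_rk (A := A) iX.
by rewrite subUset sub1set xA sI cardsU1 xnI eI add1n ltnn => /(_ isT).
Qed.

Lemma vector_cl A x : (x \in cl M A) = (phi x \in vspan A).
Proof.
apply/negb_inj/eqP; rewrite -eqb_negLR; apply/eqP.
have := rkU1 M x A; rewrite !vector_rk vspanU1 dimv_add_line => /addnI.
by case: (_ \in _); case: (_ \in _).
Qed.

Lemma vector_flatP A : reflect (forall x, phi x \in vspan A -> x \in A) (flat M A).
Proof.
apply: (iffP (flatP M A)) => [fA x|h]; first by rewrite -vector_cl fA.
apply/eqP; rewrite eqEsubset sub_cl andbT; apply/subsetP=> x.
by rewrite vector_cl; apply: h.
Qed.

Lemma vspan_ind A (P : vT -> Prop) : P 0%R ->
  (forall k x u, x \in A -> P u -> P (k *: phi x + u)%R) -> forall u, u \in vspan A -> P u.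
Proof.
move=> P0 PS; rewrite /vspan; have : {subset enum A <= A} by move=> x; rewrite mem_enum.
elim: (enum A) => [|x e IHe] sub u /=; first by rewrite span_nil memv0 => /eqP ->.
rewrite span_cons => /memv_addP[v /vlineP[k ->] [w wU ->]].
apply: PS; first by apply: sub; rewrite mem_head.
by apply: IHe wU => y ye; apply: sub; rewrite inE ye orbT.
Qed.

End VectorMatroidRank.

(** * Projective spaces as perfect matroid designs *)

Section ProjectiveSpace.
Variables (F : finFieldType) (n : nat).
Let point := pg_point F n.
Let phi (p : point) : 'rV[F]_n.+1 := nz_row (val p).

Lemma pg_nz p : phi p != 0%R.
Proof.
rewrite /phi nz_row_eq0; have /andP[/eqP r _] := valP p.
by apply: contra_eqN r => /eqP ->; rewrite mxrank0.
Qed.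

Lemma pg_val p : val p = <<phi p>>%MS.
Proof.
have /andP[/eqP r /eqP <-] := valP p; apply/eq_genmx/eqmx_sym/eqmxP.
rewrite -(geq_leqif (mxrank_leqif_eq (nz_row_sub _))) r.
by rewrite rank_rV pg_nz.
Qed.

Lemma pg_point_eq p q : phi p \in <[phi q]>%VS -> p = q.
Proof.
case/vlineP=> c e; apply: val_inj; rewrite !pg_val e; apply/eq_genmx/eqmx_scale.
by apply: contraNneq (pg_nz p) => c0; rewrite e c0 scale0r.
Qed.

Lemma pg_exists (v : 'rV[F]_n.+1) : v != 0%R -> exists2 p, phi p \in <[v]>%VS & v \in <[phi p]>%VS.
Proof.
move=> nv; have Pv : (\rank <<v>> == 1) && (<<<<v>>>>%MS == <<v>>%MS).
  by rewrite genmx_id eqxx mxrank_gen rank_rV nv.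
have [c e] : exists c, phi (Sub <<v>>%MS Pv) = (c *: v)%R.
  by apply/sub_rVP; rewrite -(genmxE v); apply: nz_row_sub.
exists (Sub <<v>>%MS Pv); first by rewrite e memvZ ?memv_line.
have nc : c != 0%R by apply: contraNneq (pg_nz (Sub <<v>>%MS Pv)) => c0; rewrite e c0 scale0r.
by apply/vlineP; exists (c^-1)%R; rewrite e scalerA mulVf // scale1r.
Qed.

(** The nonzero vectors in the span of a flat correspond to pairs of a point of the flat and a
    nonzero scalar. *)
Lemma pg_pmd : perfect_matroid_design (PG F n) n.+1 (pg_sizes #|F|).
Proof.
have dimT : vspan phi [set: point] = fullv.
  apply/eqP; rewrite eqEsubv subvf; apply/subvP=> v _.
  have [->|nv] := eqVneq v 0%R; first exact: mem0v.
  have [p _ /vlineP[c ->]] := pg_exists nv.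
  by rewrite memvZ // mem_vspan.
split; first by rewrite /rank vector_rk dimT dimvf /dim /= mul1n.
move=> A /vector_flatP fA; rewrite vector_rk; set U := vspan _ A in fA *.
have q1 : 0 < #|F| - 1 by rewrite subn_gt0 finNzRing_gt1.
rewrite /pg_sizes -(card_vspace U).
have -> : #|U| - 1 = #|A| * (#|F| - 1); last by rewrite mulnK.
have -> : #|U| - 1 = #|[set u in U | u != 0%R]|.
  rewrite (cardD1 0%R) mem0v add1n subn1 /=; apply: eq_card => u.
  by rewrite !inE andbC.
have -> : #|F| - 1 = #|[set~ (0 : F)%R]| by rewrite cardsC1 subn1.
rewrite -cardsX -(card_in_imset (f := fun x : point * F => (x.2 *: phi x.1)%R)).
  apply: eq_card => u; apply/idP/imsetP => [|[[p c]]].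
    rewrite inE => /andP[uU nu]; have [p pu /vlineP[c e]] := pg_exists nu.
    have pA : p \in A.
      by apply: fA; case/vlineP: pu => d ed; rewrite -/(phi p) ed memvZ.
    exists (p, c) => //; rewrite !inE pA /=.
    by apply: contraNneq nu => c0; rewrite e c0 scale0r.
  rewrite !inE /= => /andP[pA nc] ->.
  by rewrite memvZ ?mem_vspan // scaler_eq0 (negPf nc) (negPf (pg_nz p)).
move=> [p c] [q d]; rewrite !inE /= => /andP[pA nc] /andP[qA nd] e.
have pq : p = q.
  apply: pg_point_eq; apply/vlineP; exists (c^-1 * d)%R.
  by rewrite -scalerA -e scalerA mulVf // scale1r.
rewrite pq in e *; congr pair; apply/eqP; rewrite -subr_eq0.
have /eqP := e; rewrite -subr_eq0 -scalerBl scaler_eq0 (negPf (pg_nz q)) orbF //.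
Qed.

(** By induction along a linear combination: the point of [k *: phi x + u] lies on the line joining
    [x] to the point of [u]. *)
Lemma pg_flat (A : {set point}) :
  (forall p q r, p \in A -> q \in A -> phi r \in (<[phi p]> + <[phi q]>)%VS -> r \in A) ->
  flat (PG F n) A.
Proof.
move=> hA; apply/vector_flatP => r0 r0U.
suff h (u : 'rV[F]_n.+1) : u \in vspan phi A -> forall r, phi r \in <[u]>%VS -> r \in A.
  exact: h r0U r0 (memv_line _).
move: u; apply: vspan_ind => [r|k x u xA IHu r].
  by case/vlineP=> c; rewrite scaler0 => /eqP; rewrite (negPf (pg_nz r)).
have [->|nu] := eqVneq u 0%R.
  rewrite addr0 => /vlineP[c e]; apply: (hA x x) => //.
  by rewrite (subvP (addvSl _ _)) // e !memvZ ?memv_line.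
have [q qu uq] := pg_exists nu.
case/vlineP=> c e; apply: (hA x q) => //; first exact: IHu.
by rewrite e memvZ // memv_add // memvZ ?memv_line.
Qed.

End ProjectiveSpace.

(** * Affine spaces as perfect matroid designs *)

Section AffineSpace.
Variables (F : finFieldType) (n : nat).
Let phi (v : 'rV[F]_n) : 'rV[F]_(1 + n) := row_mx (1%:M : 'M_1) v.

Let phi_l v : phi v 0%R (lshift n 0%R) = 1%R.
Proof. by rewrite row_mxEl mxE eqxx. Qed.

Let phi_r v : rsubmx (phi v) = v.
Proof. exact: row_mxKr. Qed.

(** The span of a nonempty flat consists of one copy of the flat for each value of the first
    coordinate. *)
Lemma ag_pmd : perfect_matroid_design (AG F n) n.+1 (ag_sizes #|F|).
Proof.
have szA A : flat (AG F n) A -> #|A| = ag_sizes #|F| (rk (AG F n) A).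
  move=> /vector_flatP fA; rewrite vector_rk; set U := vspan _ A in fA *.
  have [A0|[v0 v0A]] := set_0Vmem A.
    suff -> : U = 0%VS by rewrite dimv0 A0 cards0.
    by rewrite /U A0 /vspan enum_set0 span_nil.
  have v0U : phi v0 \in U by apply: mem_vspan.
  have cU : #|F| * #|A| = #|F| ^ \dim U.
    rewrite -(card_vspace U) -cardsT -cardsX.
    (* The first coordinate of [f (c, v)] is [c]. Shifting by a multiple of [phi v0], and not
       rescaling, brings it to 1 even when [c] is 0. *)
    pose f (x : F * 'rV[F]_n) := ((x.1 - 1) *: phi v0 + phi x.2)%R.
    have f00 x : f x 0%R (lshift n 0%R) = x.1.
      by rewrite mxE mxE !phi_l mulr1 subrK.
    rewrite -(card_imset _ (_ : injective f)).
      apply: eq_card => u; apply/imsetP/idP => [[[c v]]|uU].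
        by rewrite !inE /= => vA ->; rewrite memvD ?memvZ // mem_vspan.
      pose c := u 0%R (lshift n 0%R); pose w := (u - (c - 1) *: phi v0)%R.
      have w1 : w = phi (rsubmx w).
        apply/rowP=> i; case: (split_ordP i) => j ->.
          by rewrite (ord1 j) phi_l 3!mxE phi_l mulr1 opprB addrCA subrr addr0.
        by rewrite /phi row_mxEr [RHS]mxE.
      exists (c, rsubmx w); last by rewrite /f /= -w1 addrC subrK.
      by rewrite !inE /=; apply: fA; rewrite -/(phi _) -w1 memvB ?memvZ.
    move=> [c v] [d w] e; have cd : c = d by rewrite -[LHS](f00 (c, v)) e f00.
    move: e; rewrite cd /f /= => /addrI/eq_row_mx[_ ->] //.
  have : 0 < \dim U by rewrite lt0n dimv_eq0; apply: contraTneq v0U => ->;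
    rewrite memv0; apply/eqP=> /rowP/(_ (lshift n 0%R)); rewrite phi_l mxE; apply/eqP/oner_neq0.
  case: (\dim U) cU => // d; rewrite expnS => /eqP; rewrite eqn_pmul2l; first by move/eqP.
  by apply: ltnW; apply: finNzRing_gt1.
(* The rank is read off from the number of points, [#|F| ^ n]. *)
split=> //; have := szA _ (flatT (AG F n)); rewrite cardsT card_mx mul1n -/(rank _).
case: (rank _) => [|k] /= e.
  by move: (expn_gt0 #|F| n); rewrite e (ltnW (finNzRing_gt1 F)).
by congr _.+1; apply: (@expnI #|F|) => //; apply: finNzRing_gt1.
Qed.

(** The closure condition involves three points and not two: over a field with two elements every
    set contains the lines joining its points. *)
Lemma ag_flat (A : {set 'rV[F]_n}) :
  (forall a b c t, a \in A -> b \in A -> c \in A -> c + t *: (b - a) \in A)%R ->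
  flat (AG F n) A.
Proof.
move=> hA; apply/vector_flatP => v vU.
have [A0|[a aA]] := set_0Vmem A.
  move: vU; rewrite A0 /vspan enum_set0 span_nil memv0 => /eqP/rowP/(_ (lshift n 0%R)).
  by rewrite (phi_l v) mxE => /eqP; rewrite oner_eq0.
(* For vectors of arbitrary first coordinate the missing weight is made up by [a]; at [u = phi v]
   the expression is [v]. *)
suff h (u : 'rV[F]_(1 + n)) : u \in vspan phi A ->
    (a + (rsubmx u - u 0 (lshift n 0) *: a) \in A)%R.
  by have := h _ vU; rewrite row_mxKr phi_l scale1r addrC subrK.
move: u; apply: vspan_ind => [|k x u xA IHu].
  by rewrite linear0 mxE scale0r subrr addr0.
have := hA _ _ _ k aA xA IHu; congr (_ \in A).
have -> : rsubmx (k *: phi x + u) = (k *: x + rsubmx u)%R.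
  by rewrite linearD linearZ /= phi_r.
rewrite mxE mxE phi_l mulr1 scalerDl opprD scalerBr -!addrA; congr (_ + _)%R.
by rewrite [RHS]addrCA; congr (_ + _)%R; rewrite addrC -addrA.
Qed.

End AffineSpace.

(** * Projective geometries *)

Lemma pg_sizes0 q : pg_sizes q 0 = 0.
Proof. by rewrite /pg_sizes expn0 subnn div0n. Qed.

Lemma pg_sizes_expn q i : 1 < q -> (q - 1) * pg_sizes q i = q ^ i - 1.
Proof.
move=> q1; rewrite /pg_sizes mulnC divnK // !subn1 predn_exp dvdn_mulr //.
Qed.

Lemma pg_sizesS q i : 1 < q -> pg_sizes q i.+1 = (q * pg_sizes q i).+1.
Proof.
move=> q1; have q0 : 0 < q - 1 by lia.
apply/eqP; rewrite -(eqn_pmul2l q0) pg_sizes_expn // mulnS mulnCA pg_sizes_expn // expnS.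
have := expn_gt0 q i; rewrite mulnBr; nia.
Qed.

Section Homogeneous.
Variables (F : fieldType) (k : nat).
Local Open Scope ring_scope.

(** Homogeneous coordinates: weight 1 for affine points, weight 0 for points at infinity. *)
Definition homog (a : F) (u : 'rV[F]_k) : 'rV[F]_(1 + k) := row_mx (a%:M : 'M_1) u.

Lemma homogZ c a u : c *: homog a u = homog (c * a) (c *: u).
Proof. by rewrite /homog scale_row_mx scale_scalar_mx. Qed.

Lemma homogD a u b v : homog a u + homog b v = homog (a + b) (u + v).
Proof. by rewrite /homog add_row_mx raddfD. Qed.

Lemma homog_inj a u b v : homog a u = homog b v -> a = b /\ u = v.
Proof.
case/eq_row_mx=> /matrixP/(_ 0 0); rewrite !mxE eqxx !mulr1n; by split.
Qed.

Lemma homog_eq0 a u : (homog a u == 0) = (a == 0) && (u == 0).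
Proof.
have h0 : homog 0 0 = 0 by rewrite /homog raddf0 row_mx0.
apply/eqP/andP => [|[/eqP -> /eqP ->] //]; rewrite -h0 => /homog_inj[-> ->].
by rewrite !eqxx.
Qed.

End Homogeneous.

Section ProjectiveUniqueness.
Variables (F : finFieldType) (k : nat).
Hypothesis k3 : 2 < k.
Variables (T : finType) (M : matroid T).
Let q := #|F|.
Let s := pg_sizes q.
Hypothesis pmd : perfect_matroid_design M k.+1 s.

Let q1 : 1 < q. Proof. exact: finNzRing_gt1. Qed.
Let s0 : s 0 = 0. Proof. exact: pg_sizes0. Qed.
Let sS i : s i.+1 = (q * s i).+1. Proof. exact: pg_sizesS. Qed.
Let s1 : s 1 = 1. Proof. by rewrite sS s0 muln0. Qed.
Local Notation line := (line M).

(** [join_cover] over the empty flat, where the size condition reads [s i * q = s i.+1 - 1]. *)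
Lemma projective_join (G : {set T}) x y : flat M G -> x \notin G -> y \in cl M (x |: G) ->
  y != x -> exists2 c, c \in G & y \in line x c.
Proof.
move=> fG xG yG nyx; have f0 : flat M set0 by apply/flatP/(cl_set0 pmd s0).
have [||c [cG _ yc]] := join_cover pmd f0 fG (sub0set G) xG _ yG.
- by rewrite rk0 !sS s0; lia.
- by rewrite setU0 (cl_set1 pmd s0 s1) inE.
by exists c => //; move: yc; rewrite setU0.
Qed.

Variable H : {set T}.
Hypotheses (fH : flat M H) (rH : rk M H = k).

Let E := {x : T | x \notin H}.
Let D := {x : T | x \in H}.

Lemma neq_affine (a : E) y : y \in H -> y != val a.
Proof. by apply: contraTneq => ->; apply: (valP a). Qed.

Lemma cl_hyperplane (a : E) : cl M (val a |: H) = setT.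
Proof.
apply: (flat_rk_eq (flat_cl _ _) (flatT _) (subsetT _)).
by rewrite rk_clU1 ?(valP a) // rH; case: pmd => <-.
Qed.

Lemma meet_hyperplane (a : E) y u v : u \in H -> v \in H ->
  u \in line (val a) y -> v \in line (val a) y -> u = v.
Proof.
move=> uH vH uL vL; apply/eqP; apply: contraT => nuv.
have [ay|nay] := eqVneq (val a) y.
  move: uL; rewrite -ay (line_id pmd s0 s1) inE => /eqP ua.
  by have := valP a; rewrite /= -ua uH.
have := line_l M (val a) y; rewrite -(line_eq pmd s0 s1 nay nuv uL vL).
by move/(subsetP (line_sub fH uH vH)); rewrite (negPf (valP a)).
Qed.

(** The premise stands under the existential so that a total [delta] can be chosen; at [a = b] any
    point of [H] serves. *)
Lemma dir_exists (a b : E) : exists d : D, a != b -> val d \in line (val a) (val b).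
Proof.
have [ab|nab] := eqVneq a b.
  have [|[x xH]] := set_0Vmem H; last by exists (Sub x xH).
  by move=> H0; have e := congr1 (rk M) H0; exfalso; move: k3; rewrite -rH e rk0.
have [||c cH ac] := projective_join (x := val a) (y := val b) fH (valP a).
- by rewrite cl_hyperplane.
- by rewrite eq_sym.
by exists (Sub c cH) => _; rewrite SubK (line_exchange pmd s0 s1) // eq_sym.
Qed.

Let lnH (u v : D) := [set w : D | val w \in line (val u) (val v)].

Section Directions.
Variable delta : E -> E -> D.
Hypothesis deltaP : forall a b : E, a != b -> val (delta a b) \in line (val a) (val b).

Lemma delta_uniq a b d : a != b -> val d \in line (val a) (val b) -> delta a b = d.
Proof.
move=> n dL; exact/val_inj/(meet_hyperplane (valP _) (valP d) (deltaP n) dL).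
Qed.

Lemma delta_line a b : a != b -> line (val a) (val (delta a b)) = line (val a) (val b).
Proof.
move=> n; apply: (line_eql pmd s0 s1); last exact: deltaP.
exact/neq_affine/valP.
Qed.

Lemma projective_affine_geometry : affine_geometry delta lnH.
Proof.
split.
- move=> a b; have [->//|nab] := eqVneq a b.
  by apply/esym/delta_uniq; rewrite 1?eq_sym // lineC deltaP.
- by move=> u; apply/setP=> w; rewrite !inE (line_id pmd s0 s1) inE.
- by move=> u v; rewrite inE line_l.
- by move=> u v; apply/setP=> w; rewrite !inE lineC.
- move=> u v w; rewrite inE => wL nwu; apply/setP=> x; rewrite !inE.
  by rewrite (line_eql pmd s0 s1 _ wL).
(* The plane of the triangle is spanned by any vertex together with [G], so the side [a c] meets
   [G]. *)
- move=> a b c nab nbc nac; rewrite inE.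
  set G := line (val (delta a b)) (val (delta b c)).
  have GH : G \subset H by apply: line_sub => //; apply: valP.
  have nG (e : E) : val e \notin G by apply: contra (valP e); apply: (subsetP GH).
  have bG (e : E) d : e != b -> d \in G -> d \in line (val b) (val e) -> val e \in cl M (val b |: G).
    move=> neb dG dL; have := line_exchange pmd s0 s1 _ dL.
    rewrite (contraNneq _ (nG b)) => [/(_ isT)|<- //].
    by apply: (subsetP (clS M _)); rewrite setUS // sub1set.
  have aL : val a \in cl M (val b |: G).
    by apply: (bG a (val (delta a b))); rewrite ?line_l // lineC deltaP.
  have cL : val c \in cl M (val b |: G).
    by apply: (bG c (val (delta b c))); rewrite ?line_r ?deltaP // eq_sym.
  have fG : flat M G := line_flat _ _ _.
  have e : cl M (val a |: G) = cl M (val b |: G).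
    by apply: cl_exchange => //; move/flatP: fG => ->.
  have [||h hG hc] := projective_join (x := val a) (y := val c) fG (nG a).
  + by rewrite e.
  + by rewrite eq_sym.
  have hL : h \in line (val a) (val c) by apply: (line_exchange pmd s0 s1) hc; rewrite eq_sym.
  by rewrite (delta_uniq (d := Sub h (subsetP GH h hG)) nac).
(* The point [w] lies in the plane spanned by [b] and the line [G] from [a] to [v], so the line
   [b w] meets [G]. The meet is affine: in [H] it could only be [v], forcing [v = w]. *)
- move=> v w a b nvw nab; rewrite inE => uL; set G := line (val a) (val v).
  have fG : flat M G := line_flat _ _ _.
  have nav : val a != val v by rewrite eq_sym neq_affine ?(valP v).
  have [bG|bG] := boolP (val b \in G).
    exists b; split; last by left.
    by right; apply: delta_uniq => //; apply: (line_exchange pmd s0 s1) bG; rewrite eq_sym.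
  have wG : val w \in cl M (val b |: G).
    have bw : val b \in cl M (val w |: G).
      have uw : val (delta a b) \in cl M (val w |: G).
        apply: (subsetP (line_sub (flat_cl M _) _ _)) uL; last exact: in_cl_U1.
        by rewrite (subsetP (sub_cl_U1 _ _ _)) // line_r.
      have : val b \in line (val a) (val (delta a b)) by rewrite delta_line // line_r.
      apply: (subsetP (line_sub (flat_cl M _) _ uw)).
      by rewrite (subsetP (sub_cl_U1 _ _ _)) // line_l.
    by rewrite (cl_exchange bw) ?in_cl_U1 // (flatP _ _ fG).
  have nwb : val w != val b by rewrite neq_affine ?(valP w).
  have [h hG hw] := projective_join fG bG wG nwb.
  have hH : h \notin H.
    apply: contra nvw => hH.
    have hv : h = val v by apply: (meet_hyperplane hH (valP v) hG); apply: line_r.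
    rewrite hv in hw; apply/eqP/val_inj/(@meet_hyperplane b (val v)) => //; try exact: valP.
    exact: line_r.
  exists (Sub h hH); split.
    have [->|n] := eqVneq a (Sub h hH); [by left|right].
    apply: delta_uniq => //; apply: (line_exchange pmd s0 s1) hG.
    by rewrite eq_sym -(inj_eq val_inj) in n.
  have n : b != Sub h hH by apply: contraNneq bG => ->.
  by right; apply: delta_uniq.
(* A line has [q + 1], hence at least three, points: one is left besides [a] and the point at
   infinity [u]. *)
- move=> a u; have nau : val a != val u by rewrite eq_sym neq_affine ?(valP u).
  have /subsetPn[x xL] : ~~ (line (val a) (val u) \subset [set val a; val u]).
    apply/negP=> /subset_leq_card; rewrite cards2 nau (pmd_size pmd) ?line_flat //.
    by rewrite (rk_line pmd s0 s1) // !sS s0; lia.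
  rewrite !inE negb_or => /andP[nxa nxu].
  have xH : x \notin H.
    by apply: contra nxu => xH; apply/eqP/(meet_hyperplane xH (valP u) xL)/line_r.
  have n : a != Sub x xH by rewrite -(inj_eq val_inj) eq_sym.
  by exists (Sub x xH) => //; apply: delta_uniq => //; apply: (line_exchange pmd s0 s1).
move=> u v; have /subsetPn[w wH wL] : ~~ (H \subset line (val u) (val v)).
  apply/negP=> /(rkS M); rewrite rH rk_cl; have := rk_le_card M [set val u; val v].
  by rewrite cards2; case: eqP => /=; lia.
by exists (Sub w wH); rewrite inE.
Qed.

Lemma card_delta a u : #|[set x | on delta [set u] a x]| = q.
Proof.
have nau : val a != val u by rewrite eq_sym neq_affine ?(valP u).
have := cardsD1 (val u) (line (val a) (val u)); rewrite line_r.
rewrite (pmd_size pmd) ?line_flat // (rk_line pmd s0 s1) // !sS s0 muln0 muln1 add1n.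
move=> [->]; rewrite -(card_imset _ val_inj); apply: eq_card => x; apply/imsetP/idP => [[y]|].
  rewrite !inE => /orP[/eqP <- ->|]; first by rewrite nau line_l.
  rewrite in_set1; have [<- _ ->|nay /eqP <- ->] := eqVneq a y; first by rewrite nau line_l.
  by rewrite delta_line // line_r andbT eq_sym neq_affine // (valP (delta a y)).
rewrite !inE => /andP[nxu xL].
have xH : x \notin H.
  by apply: contra nxu => xH; apply/eqP/(meet_hyperplane xH (valP u) xL)/line_r.
exists (Sub x xH) => //; rewrite inE /on inE; have [//|n /=] := eqVneq a (Sub x xH).
apply/eqP/delta_uniq => //; apply: (line_exchange pmd s0 s1) xL.
by rewrite eq_sym -(inj_eq val_inj) in n.
Qed.

End Directions.

Lemma card_affine_part : #|{: E}| = q ^ k.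
Proof.
rewrite card_sig; have -> : #|[pred x | x \notin H]| = #|~: H|.
  by apply: eq_card => x; rewrite !inE.
rewrite cardsCs setCK (pmd_card pmd) (pmd_size pmd fH) rH sS -/s.
have := pg_sizes_expn k q1; rewrite -/s; have := expn_gt0 q k; rewrite (ltnW q1) /=.
nia.
Qed.

(** The affine coordinates [f] are completed to homogeneous ones: [h] is [(1, f e)] on affine points
    and [(0, w d)] on points of [H], and [g x] is the projective point spanned by [h x]. *)
Lemma projective_isomorphic_hyperplane : isomorphic M (PG F k).
Proof.
have /fin_all_exists[de de_P] (a : E) : exists f : E -> D, forall b, a != b -> val (f b) \in line (val a) (val b).
  exact: fin_all_exists (dir_exists a).
have ag := projective_affine_geometry de_P.
have [f [fb fP]] := affine_coordinates ag (card_delta de_P) card_affine_part.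
have [f' fK f'K] := fb; have inj_f := bij_inj fb.
have [o _] : exists o : E, o \in {: E}.
  by apply/card_gt0P; rewrite card_affine_part expn_gt0 (ltnW q1).
(* [w d] is a vector of direction [d], the difference of two points joined in that direction; all
   other such differences are multiples of it. *)
have /fin_all_exists[w wP] (d : D) : exists w : 'rV[F]_k, w != 0%R /\
    forall a b, a != b -> de a b = d <-> exists t : F, (f b - f a = t *: w)%R.
  have [b nob dob] := delta_ex ag o d; exists (f b - f o)%R; split.
    by rewrite subr_eq0 (inj_eq inj_f) eq_sym.
  by move=> a c nac; rewrite -(fP _ _ _ _ nob nac) dob; split=> ->.
have w0 d : w d != 0%R by case: (wP d).
have wE a b d t : a != b -> (f b - f a = t *: w d)%R -> de a b = d.
  by move=> nab e; apply/(proj2 (wP d)) => //; exists t.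
have step a d t : t != 0%R -> exists b, [/\ a != b, f b = (f a + t *: w d)%R & de a b = d].
  move=> nt; exists (f' (f a + t *: w d)%R).
  have e : (f (f' (f a + t *: w d)) - f a = t *: w d)%R by rewrite f'K addrAC subrr add0r.
  have n : a != f' (f a + t *: w d)%R.
    rewrite -(inj_eq inj_f) eq_sym -subr_eq0 e scaler_eq0 (negPf nt).
    exact: w0.
  by rewrite f'K; split=> //; apply: wE e.
have cases x : (exists e : E, x = val e) \/ (exists d : D, x = val d).
  by have [xH|xH] := boolP (x \in H); [right; exists (Sub x xH)|left; exists (Sub x xH)].
have /fin_all_exists[h hP] (x : T) : exists u : 'rV[F]_(1 + k),
    (forall e : E, val e = x -> u = homog 1 (f e)) /\ (forall d : D, val d = x -> u = homog 0 (w d)).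
  case: (cases x) => -[y ->].
    exists (homog 1 (f y)); split=> [e /val_inj -> //|d e].
    by have := neq_affine y (valP d); rewrite e eqxx.
  exists (homog 0 (w y)); split=> [e ey|d /val_inj -> //].
  by have := neq_affine e (valP y); rewrite ey eqxx.
have hE (e : E) : h (val e) = homog 1 (f e) by apply: (proj1 (hP _)).
have hD (d : D) : h (val d) = homog 0 (w d) by apply: (proj2 (hP _)).
have h0 x : h x != 0%R.
  by case: (cases x) => -[y ->]; rewrite ?hE ?hD homog_eq0 ?oner_eq0 ?eqxx //= w0.
have h_par x y c : h x = (c *: h y)%R -> x = y.
  case: (cases x) => -[x' ->]; case: (cases y) => -[y' ->]; rewrite ?hE ?hD homogZ => /homog_inj[].
  - by rewrite mulr1 => <-; rewrite scale1r => /inj_f ->.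
  - by rewrite mulr0 => /eqP; rewrite oner_eq0.
  - by rewrite mulr1 => <-; rewrite scale0r => /eqP; rewrite (negPf (w0 _)).
  move=> _ e; have [b [nob fb' <-]] := step o x' 1%R (oner_neq0 F).
  by rewrite (wE o b y' c) // fb' scale1r e addrAC subrr add0r.
(* Dependent coordinates imply collinear points; this is the implication that [pg_flat] calls
   for. *)
have h_line x y z c d : x != y -> h z = (c *: h x + d *: h y)%R -> z \in line x y.
  move=> nxy; have [->|nc] := eqVneq c 0%R.
    by rewrite scale0r add0r => /h_par ->; apply: line_r.
  have [->|nd] := eqVneq d 0%R.
    by rewrite scale0r addr0 => /h_par ->; apply: line_l.
  have mixed (e : E) (u : D) c' d' : c' != 0%R -> d' != 0%R ->
      h z = (c' *: h (val e) + d' *: h (val u))%R -> z \in line (val e) (val u).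
    move=> nc' nd'; rewrite hE hD !homogZ homogD; case: (cases z) => -[z' ->].
      rewrite hE => /homog_inj[]; rewrite mulr1 mulr0 addr0 => <-; rewrite scale1r => ez.
      have e1 : (f z' - f e = d' *: w u)%R by rewrite ez addrAC subrr add0r.
      have nez : e != z' by rewrite -(inj_eq inj_f) eq_sym -subr_eq0 e1 scaler_eq0 (negPf nd') w0.
      by rewrite -(wE _ _ _ _ nez e1) (delta_line de_P) // line_r.
    by rewrite hD => /homog_inj[]; rewrite mulr1 mulr0 addr0 => c0; rewrite -c0 eqxx in nc'.
  case: (cases x) nxy => -[x' ->]; case: (cases y) => -[y' ->] nxy; last 1 first.
  - rewrite !hD !homogZ homogD; case: (cases z) => -[z' ->].
      by rewrite hE => /homog_inj[/eqP]; rewrite !mulr0 addr0 oner_eq0.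
    rewrite hD => /homog_inj[_ ez].
    (* Two points at infinity: walk from [o] along multiples of [w x'] and [w y']; the triangle
       axiom places the total direction [z'] on the line joining [x'] and [y']. *)
    have [b [nob fb1 db1]] := step o x' c nc; have [b2 [nb2 fb2 db2]] := step b y' d nd.
    have fb3 : (f b2 = f o + w z')%R by rewrite fb2 fb1 ez addrA.
    have e1 : (f b2 - f o = 1 *: w z')%R by rewrite fb3 scale1r addrAC subrr add0r.
    have no2 : o != b2 by rewrite -(inj_eq inj_f) eq_sym -subr_eq0 e1 scale1r w0.
    have := delta_tri ag nob nb2 no2; rewrite db1 db2 (wE _ _ _ _ no2 e1).
    by rewrite inE.
  - rewrite !hE !homogZ homogD !mulr1; have nxy' : x' != y' by apply: contraNneq nxy => ->.
    (* Weight and displacement are separated: [c + d] equal to 1 gives an affine point of the line,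
       equal to 0 its point at infinity. *)
    have eqn : (c *: f x' + d *: f y' = (c + d) *: f x' + d *: (f y' - f x'))%R.
      by rewrite scalerDl scalerBr -addrA [(_ + (_ - _))%R]addrCA subrr addr0.
    case: (cases z) => -[z' ->].
      rewrite hE eqn => /homog_inj[cd ez]; rewrite -cd scale1r in ez.
      have [<-|nxz] := eqVneq x' z'; first exact: line_l.
      have e1 : (f z' - f x' = d *: (f y' - f x'))%R by rewrite ez addrAC subrr add0r.
      have e2 : de x' y' = de x' z' by apply/fP => //; exists d.
      by rewrite -(delta_line de_P nxy') e2 (delta_line de_P nxz) line_r.
    rewrite hD eqn => /homog_inj[cd ez]; rewrite -cd scale0r add0r in ez.
    have e1 : (f y' - f x' = d^-1 *: w z')%R by rewrite ez scalerA mulVf // scale1r.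
    by rewrite -(wE _ _ _ _ nxy' e1); apply: de_P.
  - exact: mixed.
  - by rewrite addrC lineC; apply: mixed.
have /fin_all_exists[g gP] (x : T) : exists p : pg_point F k,
    nz_row (val p) \in <[h x]>%VS /\ h x \in <[nz_row (val p)]>%VS.
  by have [p p1 p2] := pg_exists (h0 x); exists p.
have inj_g : injective g.
  move=> x y e; have [_ /vlineP[c ec]] := gP x; have [/vlineP[d ed] _] := gP y.
  by apply: (@h_par x y (c * d)%R); rewrite ec e ed scalerA.
have gb : bijective g.
  by apply: inj_card_bij; rewrite // (pmd_card pmd) (pmd_card (pg_pmd F k)).
apply: (pmd_isomorphic pmd (pg_pmd F k) gb) => A fA; apply: pg_flat => p p' p''.
case/imsetP=> x xA ->; case/imsetP=> y yA ->; have [g' _ g'K] := gb; rewrite -{1 2}(g'K p'').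
set z := g' p'' => hz; apply/imset_f.
have [_ hz'] := gP z; have [hx _] := gP x; have [hy _] := gP y.
have : h z \in (<[h x]> + <[h y]>)%VS.
  have sub : (<[nz_row (val (g x))]> + <[nz_row (val (g y))]> <= <[h x]> + <[h y]>)%VS.
    by apply: addvS; rewrite -memvE.
  by case/vlineP: hz' => c ->; rewrite memvZ // (subvP sub).
case/memv_addP=> _ /vlineP[c ->] [_ /vlineP[d ->] e].
have [xy|nxy] := eqVneq x y.
  by move: e; rewrite -xy -scalerDl => /h_par ->.
exact: (subsetP (line_sub fA xA yA)) (h_line _ _ _ _ _ nxy e).
Qed.

End ProjectiveUniqueness.

Lemma pg_isomorphic (F : finFieldType) k (T : finType) (M : matroid T) : 2 < k ->
  perfect_matroid_design M k.+1 (pg_sizes #|F|) -> isomorphic M (PG F k).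
Proof.
move=> k3 p; have [|H fH [_ rH]] := exists_flat_below (k := k) (flatT M).
  by rewrite rk_setT; case: p => ->.
exact: (projective_isomorphic_hyperplane k3 p fH rH).
Qed.

(** * Affine geometries *)

Section AffineUniqueness.
Variables (F : finFieldType) (k : nat).
Hypothesis k3 : 2 < k.
Variables (T : finType) (M : matroid T).
Let q := #|F|.
Let s := ag_sizes q.
Hypothesis pmd : perfect_matroid_design M k.+1 s.

Let q1 : 1 < q. Proof. exact: finNzRing_gt1. Qed.
Let s0 : s 0 = 0. Proof. by []. Qed.
Let s1 : s 1 = 1. Proof. by []. Qed.
Local Notation line := (line M).
Implicit Types (x y z : T) (l m P G : {set T}).

(** [join_cover] over the flat [[set z]]. Over the empty flat the size condition fails once [G] has
    rank at least 2, since a line through [x] may be parallel to [G]. *)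
Lemma affine_join G x y z : flat M G -> z \in G -> x \notin G -> y \in cl M (x |: G) ->
  y \notin line x z -> exists c, [/\ c \in G, c != z & y \in cl M (x |: [set c; z])].
Proof.
move=> fG zG xG yG yL; have fz := flat_set1 pmd s0 s1 z.
have [||c [cG cz yc]] := join_cover pmd fz fG _ xG _ yG yL; first by rewrite sub1set.
  rewrite (rk_set1 pmd s0) /s /=; have : 0 < rk M G by rewrite -(rk_set1 pmd s0 z) rkS // sub1set.
  by case: (rk M G) => // i _; rewrite /= expn0 expn1 !mulnBl !mulnBr !expnS expn0 !muln1; nia.
by exists c; split=> //; move: cz; rewrite inE.
Qed.

(* Affine form of the dimension formula: a plane meeting [G] meets it in a line. *)
Lemma plane_meet G P x z : flat M G -> flat M P -> z \in G -> z \in P ->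
  x \in P -> x \notin G -> rk M P = 3 -> P \subset cl M (x |: G) ->
  exists c, [/\ c \in G, c \in P & c != z].
Proof.
move=> fG fP zG zP xP xG rP sP.
have nxz : x != z by apply: contraNneq xG => ->.
have /subsetPn[y yP yL] : ~~ (P \subset line x z).
  by apply/negP=> /(rkS M); rewrite rP (rk_line pmd s0 s1).
have [c [cG ncz yc]] := affine_join fG zG xG (subsetP sP y yP) yL.
have cL : c \notin line x z.
  apply: contra xG => cL; rewrite lineC in cL.
  apply: (subsetP (line_sub fG zG cG)).
  by rewrite (line_eql pmd s0 s1 ncz cL) line_r.
exists c; split=> //; have fL := line_flat M x z.
have LP : line x z \subset P by apply: line_sub.
have yc' : y \in cl M (c |: line x z).
  apply: (subsetP (clS M _)) yc; apply/subsetP=> w; rewrite !inE.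
  by case/or3P=> /eqP ->; rewrite ?eqxx ?line_l ?line_r ?orbT.
have := cl_exchange yc'; rewrite (flatP _ _ fL) => /(_ yL) e.
apply: (subsetP (_ : cl M (y |: line x z) \subset P)); last by rewrite e in_cl_U1.
by rewrite cl_sub // subUset sub1set yP.
Qed.

Definition is_line l := flat M l && (rk M l == 2).

Lemma is_line_line x y : x != y -> is_line (line x y).
Proof. by move=> n; rewrite /is_line line_flat (rk_line pmd s0 s1) ?eqxx. Qed.

Lemma line_of l x y : is_line l -> x \in l -> y \in l -> x != y -> l = line x y.
Proof.
case/andP=> fl /eqP rl xl yl n; apply/esym/(@flat_rk_eq _ M); rewrite ?line_flat //.
  exact: line_sub.
by rewrite rl (rk_line pmd s0 s1).
Qed.

Lemma card_line l : is_line l -> #|l| = q.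
Proof. by case/andP=> fl /eqP rl; rewrite (pmd_size pmd) // rl /s /= expn1. Qed.

Lemma line_other l x : is_line l -> exists2 y, y \in l & y != x.
Proof.
move=> /card_line cl2; have /subsetPn[y yl] : ~~ (l \subset [set x]).
  by apply/negP=> /subset_leq_card; rewrite cards1 cl2 leqNgt q1.
by rewrite inE => n; exists y.
Qed.

Lemma line_point l : is_line l -> exists x, x \in l.
Proof. by move=> /card_line cl2; apply/card_gt0P; rewrite cl2 ltnW. Qed.

Lemma lines_eq l m x y : is_line l -> is_line m -> x \in l -> y \in l -> x \in m -> y \in m ->
  x != y -> l = m.
Proof. by move=> il im xl yl xm ym n; rewrite (line_of il xl yl n) -(line_of im xm ym n). Qed.

Lemma plane_eq P l x : flat M P -> rk M P = 3 -> is_line l -> l \subset P -> x \in P ->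
  x \notin l -> P = cl M (x |: l).
Proof.
move=> fP rP /andP[fl /eqP rl] lP xP xl; apply: (cover_cl fl fP lP) => //.
by rewrite rP rl.
Qed.

(** The [q] lines joining [x] to [l] cover [q * (q - 1)] of the [q ^ 2 - 1] other points of the
    plane; what remains is exactly enough for one more line through [x]. *)
Lemma playfair_card P l x : flat M P -> rk M P = 3 -> is_line l -> l \subset P -> x \in P ->
  x \notin l -> #|[set z in P | (z != x) && [disjoint line x z & l]]| = q - 1.
Proof.
move=> fP rP il lP xP xl.
have nx y : y \in l -> x != y by move=> yl; apply: contraNneq xl => ->.
have -> : [set z in P | (z != x) && [disjoint line x z & l]] =
    (P :\ x) :\: \bigcup_(y in l) (line x y :\ x).
  apply/setP=> z; rewrite !inE; case: (z \in P); rewrite ?andbF // andbT.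
  case: (eqVneq z x) => [|nzx]; rewrite ?andbF //= andbT.
  apply/idP/negP => [dz /bigcupP[y yl]|none].
    rewrite !inE nzx /= => zL; have /disjoint_setI0/setP/(_ y) := dz.
    by rewrite !inE yl andbT (line_exchange pmd s0 s1 nzx zL).
  rewrite -setI_eq0; apply/eqP/setP=> y; rewrite !inE; apply/negP=> /andP[yL yl].
  case: none; apply/bigcupP; exists y; rewrite // !inE nzx /=.
  by apply: (line_exchange pmd s0 s1) yL; rewrite eq_sym nx.
have sub : \bigcup_(y in l) (line x y :\ x) \subset P :\ x.
  by apply/bigcupsP=> y yl; apply: setSD; apply: line_sub; rewrite // (subsetP lP).
rewrite cardsD (setIidPr sub) card_bigcup_disjoint => [|y z yl zl nyz].
  rewrite (eq_bigr (fun=> q - 1)) => [|y yl].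
    rewrite sum_nat_const (card_line il); have := cardsD1 x P.
    rewrite xP (pmd_size pmd) // rP /s /= !expnS expn0 muln1 add1n; nia.
  have := cardsD1 x (line x y); rewrite line_l (card_line (is_line_line (nx y yl))).
  by rewrite add1n => ->; rewrite subn1.
rewrite -setI_eq0; apply/eqP/setP=> w; rewrite !inE; apply/negP=> /andP[/andP[nw wy] /andP[_ wz]].
have e : line x y = line x z.
  by rewrite -(line_eql pmd s0 s1 nw wy) -(line_eql pmd s0 s1 nw wz).
have yz : l = line x y.
  by apply: (lines_eq il (is_line_line (nx y yl)) yl zl); rewrite ?line_r // e line_r.
by rewrite yz line_l in xl.
Qed.

Lemma playfair_exists P l x : flat M P -> rk M P = 3 -> is_line l -> l \subset P -> x \in P ->
  x \notin l -> exists m, [/\ is_line m, x \in m, m \subset P & [disjoint m & l]].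
Proof.
move=> fP rP il lP xP xl; have := playfair_card fP rP il lP xP xl.
have [->|[z]] := set_0Vmem [set z in P | (z != x) && [disjoint line x z & l]].
  by rewrite cards0 => e; have := q1; lia.
rewrite !inE => /and3P[zP nzx dz] _; exists (line x z); split=> //.
- by rewrite is_line_line 1?eq_sym.
- exact: line_l.
- exact: line_sub.
Qed.

(** A parallel through [x], with [x] removed, lies in the set counted by [playfair_card] and has its
    size, hence fills it. *)
Lemma playfair_uniq P l x m m' : flat M P -> rk M P = 3 -> is_line l -> l \subset P ->
  is_line m -> is_line m' -> x \in m -> x \in m' -> m \subset P -> m' \subset P ->
  [disjoint m & l] -> [disjoint m' & l] -> m = m'.
Proof.
move=> fP rP il lP im im' xm xm' mP m'P dm dm'.
have xl : x \notin l by rewrite (disjointFr dm xm).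
have key n : is_line n -> x \in n -> n \subset P -> [disjoint n & l] ->
    n :\ x = [set z in P | (z != x) && [disjoint line x z & l]].
  move=> inn xn nP dn; apply/eqP; rewrite eqEcard; apply/andP; split.
    apply/subsetP=> z; rewrite !inE => /andP[nzx zn].
    by rewrite (subsetP nP) //= nzx -(line_of inn xn zn) // eq_sym.
  rewrite (playfair_card fP rP il lP (subsetP nP x xn) xl).
  by have := cardsD1 x n; rewrite xn (card_line inn) add1n => ->; rewrite subn1.
by rewrite -(setD1K xm) -(setD1K xm') !key.
Qed.

Definition par l m := l = m \/
  [disjoint l & m] /\ exists P, [/\ flat M P, rk M P = 3, l \subset P & m \subset P].

Lemma par_refl l : par l l. Proof. by left. Qed.

Lemma par_sym l m : par l m -> par m l.
Proof.
by case=> [->|[d [P [fP rP lP mP]]]]; [left|right; rewrite disjoint_sym; split=> //; exists P].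
Qed.

Lemma par_in G l m x : is_line l -> flat M G -> l \subset G -> par l m -> x \in m -> x \in G ->
  m \subset G.
Proof.
move=> il fG lG [<- //|[d [P [fP rP lP mP]]]] xm xG.
apply: (subset_trans mP).
rewrite (plane_eq fP rP il lP (subsetP mP x xm)) ?(disjointFl d xm) //.
by rewrite cl_sub // subUset sub1set xG.
Qed.

Lemma par_uniq l m m' x : is_line l -> is_line m -> is_line m' -> par l m -> par l m' ->
  x \in m -> x \in m' -> m = m'.
Proof.
move=> il im im' p p' xm xm'; have [xl|xl] := boolP (x \in l).
  have e n : par l n -> x \in n -> n = l.
    by case=> [->//|[d _] xn]; rewrite (disjointFr d xl) in xn.
  exact: etrans (e m p xm) (esym (e m' p' xm')).
have [lm|[d [P [fP rP lP mP]]]] := p; first by rewrite lm xm in xl.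
have [lm'|[d' _]] := p'; first by rewrite lm' xm' in xl.
rewrite disjoint_sym in d; rewrite disjoint_sym in d'.
have m'P : m' \subset P by apply: (par_in il fP lP p' xm'); apply: (subsetP mP).
exact: (playfair_uniq fP rP il lP im im' xm xm' mP m'P d d').
Qed.

Lemma par_exists l x : is_line l -> exists m, [/\ is_line m, par l m & x \in m].
Proof.
move=> il; have [xl|xl] := boolP (x \in l); first by exists l; split=> //; left.
have /andP[fl /eqP rl] := il.
have rP : rk M (cl M (x |: l)) = 3 by rewrite rk_clU1 // rl.
have [m [im xm mP d]] :=
  playfair_exists (flat_cl M _) rP il (sub_cl_U1 M x l) (in_cl_U1 M x l) xl.
exists m; split=> //; right; rewrite disjoint_sym; split=> //.
by exists (cl M (x |: l)); rewrite flat_cl rP sub_cl_U1.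
Qed.

(** The case of substance is that of lines not in one plane. The plane spanned by [l] and a point
    [p] of [n] meets the plane [Q] of [m] and [n] in a second point [c], by [plane_meet]. A common
    point of [m] and [p c] would put [p] in the plane of [l] and [m]; so [p c] is parallel to [m],
    and [n] is the line [p c], coplanar with [l]. *)
Lemma par_trans l m n : is_line l -> is_line m -> is_line n -> par l m -> par m n -> par l n.
Proof.
move=> il im inn plm pmn.
have [lm|[dlm [P [fP rP lP mP]]]] := plm; first by rewrite lm.
have [mn|[dmn [Q [fQ rQ mQ nQ]]]] := pmn; first by rewrite -mn.
have [->|nln] := eqVneq l n; [by left|right].
have [nP|nP] := boolP (n \subset P).
  split; last by exists P.
  rewrite -setI_eq0; apply: contraNT nln => /set0Pn[x]; rewrite inE => /andP[xl xn].
  exact/eqP/(par_uniq im il inn (par_sym plm) pmn xl xn).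
have QP y : y \in Q -> y \in P -> y \in m.
  move=> yQ yP; apply: contraNT nP => ym.
  by rewrite (plane_eq fP rP im mP yP ym) -(plane_eq fQ rQ im mQ yQ ym).
have nnP y : y \in n -> y \notin P.
  by move=> yn; apply/negP=> /(QP _ (subsetP nQ y yn)) ym; rewrite (disjointFr dmn ym) in yn.
have [p pn] := line_point inn; have pP := nnP p pn.
have pl : p \notin l by apply: contra pP; apply: (subsetP lP).
have [x xl] := line_point il; have xP := subsetP lP x xl.
have xm : x \notin m by rewrite (disjointFr dlm xl).
have xQ : x \notin Q by apply: contra xm => xQ; apply: QP.
have rR : rk M (cl M (p |: l)) = 3 by case/andP: il => fl /eqP rl; rewrite rk_clU1 // rl.
have sR : cl M (p |: l) \subset cl M (x |: Q).
  rewrite cl_sub ?flat_cl // subUset sub1set (subsetP (sub_cl_U1 _ _ _)) ?(subsetP nQ) //=.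
  by apply: subset_trans lP _; rewrite (plane_eq fP rP im mP xP xm) clS // setUS.
have [c [cQ cR ncp]] := plane_meet fQ (flat_cl M _) (subsetP nQ p pn) (in_cl_U1 M p l)
  (subsetP (sub_cl_U1 M p l) x xl) xQ rR sR.
have npc : p != c by rewrite eq_sym.
have jQ : line p c \subset Q := line_sub fQ (subsetP nQ p pn) cQ.
have jR : line p c \subset cl M (p |: l) := line_sub (flat_cl M _) (in_cl_U1 M p l) cR.
have dmj : [disjoint m & line p c].
  rewrite -setI_eq0; apply: contraNT pP => /set0Pn[y]; rewrite inE => /andP[ym yj].
  have yl : y \notin l by rewrite (disjointFl dlm ym).
  rewrite (plane_eq fP rP il lP (subsetP mP y ym) yl).
  by rewrite -(plane_eq (flat_cl M _) rR il (sub_cl_U1 _ _ _) (subsetP jR y yj) yl) in_cl_U1.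
have pmj : par m (line p c) by right; split=> //; exists Q.
have nj : n = line p c by apply: (par_uniq im inn (is_line_line npc) pmn pmj pn); apply: line_l.
split; last by exists (cl M (p |: l)); rewrite flat_cl rR sub_cl_U1 nj.
rewrite -setI_eq0; apply/eqP/setP=> y; rewrite !inE; apply/negP=> /andP[yl yn].
by have := nnP y yn; rewrite (subsetP lP).
Qed.

Lemma line_subset_eq l m : is_line l -> is_line m -> l \subset m -> l = m.
Proof.
case/andP=> fl /eqP rl /andP[fm /eqP rm] lm; apply: (flat_rk_eq fl fm lm).
by rewrite rl rm.
Qed.

Lemma rk_two_lines l m x : is_line l -> is_line m -> x \in l -> x \in m -> l != m ->
  rk M (cl M (l :|: m)) = 3.
Proof.
move=> il im xl xm nlm; have /subsetPn[y ym yl] : ~~ (m \subset l).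
  by apply: contra nlm => ml; rewrite (line_subset_eq im il ml).
have nxy : x != y by apply: contraNneq yl => <-.
have /andP[fl /eqP rl] := il.
suff -> : cl M (l :|: m) = cl M (y |: l) by rewrite rk_clU1 // rl.
apply/eqP; rewrite eqEsubset [X in _ && X]clS; last first.
  by rewrite subUset sub1set inE ym orbT subsetUl.
rewrite andbT cl_sub ?flat_cl // subUset sub_cl_U1 (line_of im xm ym nxy) line_sub ?flat_cl //.
  by rewrite (subsetP (sub_cl_U1 _ _ _)).
exact: in_cl_U1.
Qed.

(* Parallel planes have the same directions. *)
Lemma par_plane l m n l' m' n' x y : is_line l -> is_line m -> is_line n ->
  is_line l' -> is_line m' -> is_line n' -> x \in l -> x \in m -> x \in n ->
  y \in l' -> y \in m' -> y \in n' -> par l l' -> par m m' -> par n n' -> l != m ->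
  n \subset cl M (l :|: m) -> n' \subset cl M (l' :|: m').
Proof.
move=> il im inn il' im' inn' xl xm xn yl ym yn pl pm pn nlm.
set P := cl M (l :|: m) => nP; have fP : flat M P := flat_cl M _.
have rP : rk M P = 3 := rk_two_lines il im xl xm nlm.
have lP : l \subset P by apply: subset_trans (sub_cl M _); apply: subsetUl.
have mP : m \subset P by apply: subset_trans (sub_cl M _); apply: subsetUr.
have nlm' : l' != m'.
  apply: contraNneq nlm => e; apply/eqP; apply: (par_uniq il' il im (par_sym pl) _ xl xm).
  by rewrite e; apply: par_sym.
set P' := cl M (l' :|: m'); have fP' : flat M P' := flat_cl M _.
have rP' : rk M P' = 3 := rk_two_lines il' im' yl ym nlm'.
have lP' : l' \subset P' by apply: subset_trans (sub_cl M _); apply: subsetUl.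
have mP' : m' \subset P' by apply: subset_trans (sub_cl M _); apply: subsetUr.
(* Planes with a common point [z] coincide, because both contain the parallels to [l] and [m]
   through [z]. *)
have eq_planes z : z \in P -> z \in P' -> P' = P.
  move=> zP zP'.
  have [l1 [il1 pl1 zl1]] := par_exists z il; have [m1 [im1 pm1 zm1]] := par_exists z im.
  have nlm1 : l1 != m1.
    apply: contraNneq nlm => e; apply/eqP; apply: (par_uniq il1 il im (par_sym pl1) _ xl xm).
    by rewrite e; apply: par_sym.
  have both a a1 a' : is_line a -> is_line a1 -> is_line a' -> a \subset P -> a' \subset P' ->
      par a a1 -> par a a' -> z \in a1 -> (a1 \subset P) && (a1 \subset P').
    move=> ia ia1 ia' aP aP' pa1 pa' za1; rewrite (par_in ia fP aP pa1 za1 zP).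
    by rewrite (par_in ia' fP' aP' _ za1 zP') //; apply: par_trans pa1 => //; apply: par_sym.
  have /andP[l1P l1P'] := both _ _ _ il il1 il' lP lP' pl1 pl zl1.
  have /andP[m1P m1P'] := both _ _ _ im im1 im' mP mP' pm1 pm zm1.
  have r1 := rk_two_lines il1 im1 zl1 zm1 nlm1.
  have e Q : flat M Q -> rk M Q = 3 -> l1 \subset Q -> m1 \subset Q -> cl M (l1 :|: m1) = Q.
    move=> fQ rQ lQ mQ; apply: (flat_rk_eq (flat_cl M _) fQ); rewrite ?r1 ?rQ //.
    by rewrite cl_sub // subUset lQ.
  by rewrite -(e P') // -(e P).
have [yP|yP] := boolP (y \in P).
  rewrite (eq_planes y yP (subsetP lP' y yl)).
  exact: par_in pn yn yP.
have yn0 : y \notin n by apply: contra yP; apply: (subsetP nP).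
have xP' : x \notin P'.
  apply: contra yP => xP'; rewrite -(eq_planes x (subsetP lP x xl) xP').
  exact: (subsetP lP').
(* The planes [P] and [P'] are now disjoint. The plane of [y] and [n] meets [P'] in a line through
   [y], which cannot meet [n]; it is the parallel [n']. *)
have rK : rk M (cl M (y |: n)) = 3 by case/andP: inn => fn /eqP rn; rewrite rk_clU1 // rn.
have sK : cl M (y |: n) \subset cl M (x |: P').
  have sP' : P' \subset cl M (x |: P') by apply: sub_cl_U1.
  rewrite cl_sub ?flat_cl // subUset sub1set (subsetP sP') ?(subsetP lP') //=.
  apply: subset_trans nP _; rewrite cl_sub ?flat_cl // subUset.
  rewrite (par_in il' (flat_cl M _) (subset_trans lP' sP') (par_sym pl) xl) ?in_cl_U1 //.
  by rewrite (par_in im' (flat_cl M _) (subset_trans mP' sP') (par_sym pm) xm) ?in_cl_U1.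
have [c [cP' cK ncy]] := plane_meet fP' (flat_cl M _) (subsetP lP' y yl) (in_cl_U1 M y n)
  (subsetP (sub_cl_U1 M y n) x xn) xP' rK sK.
have nyc : y != c by rewrite eq_sym.
have jP' : line y c \subset P' := line_sub fP' (subsetP lP' y yl) cP'.
have jK : line y c \subset cl M (y |: n) := line_sub (flat_cl M _) (in_cl_U1 M y n) cK.
have pj : par n (line y c).
  right; split; last by exists (cl M (y |: n)); rewrite flat_cl rK sub_cl_U1.
  rewrite -setI_eq0; apply/eqP/setP=> z; rewrite !inE; apply/negP=> /andP[zn zj].
  move: yP; rewrite -(eq_planes z (subsetP nP z zn) (subsetP jP' z zj)).
  by rewrite (subsetP lP').
by rewrite (par_uniq inn inn' (is_line_line nyc) pn pj yn (line_l _ _ _)).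
Qed.

Section Directions.
Variable o : T.

(** A parallel class is represented by its member through [o], so that equal directions are equal
    elements. *)
Let D := {l : {set T} | is_line l && (o \in l)}.

Let D_line (d : D) : is_line (val d).
Proof. by case/andP: (valP d). Qed.

Let D_o (d : D) : o \in val d.
Proof. by case/andP: (valP d). Qed.

Lemma affine_dir_exists a b : exists d : D, a != b -> par (line a b) (val d).
Proof.
suff [d dP] : exists d : D, forall l, is_line l -> l = line a b -> par l (val d).
  by exists d => nab; apply: dP => //; apply: is_line_line.
have ex l : is_line l -> exists d : D, par l (val d).
  move=> il; have [m [im pm om]] := par_exists o il.
  have Pm : is_line m && (o \in m) by rewrite im.
  by exists (Sub m Pm).
have [nab|nab] := eqVneq a b; last first.
  by have [d pd] := ex _ (is_line_line nab); exists d => l _ ->.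
have [l il] : exists l, is_line l.
  have [l fl [_ rl]] := exists_flat_below (flatT M)
    (ltac:(by rewrite rk_setT; case: pmd => -> _; lia) : 2 <= rk M setT).
  by exists l; rewrite /is_line fl rl eqxx.
have [d _] := ex l il; exists d => l' /andP[_ /eqP rl'] e.
by move: rl'; rewrite e nab (line_id pmd s0 s1) (rk_set1 pmd s0).
Qed.

Let lnD (u v : D) := [set w : D | val w \subset cl M (val u :|: val v)].

Variable delta : T -> T -> D.
Hypothesis deltaP : forall a b, a != b -> par (line a b) (val (delta a b)).

Lemma affine_delta_uniq a b (d : D) : a != b -> par (line a b) (val d) -> delta a b = d.
Proof.
move=> nab p; apply/val_inj.
exact: par_uniq (is_line_line nab) (D_line _) (D_line d) (deltaP nab) p (D_o _) (D_o d).
Qed.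

Lemma delta_par l a b (d : D) : is_line l -> a \in l -> b \in l -> a != b -> par l (val d) ->
  delta a b = d.
Proof. by move=> il al bl nab p; apply: affine_delta_uniq => //; rewrite -(line_of il al bl nab). Qed.

Lemma delta_eq_par a b c d : a != b -> c != d -> delta a b = delta c d ->
  par (line a b) (line c d).
Proof.
move=> nab ncd e; apply: par_trans (deltaP nab) _; try exact: is_line_line; first exact: D_line.
by rewrite e; apply/par_sym/deltaP.
Qed.

Lemma par_D (u v : D) : par (val u) (val v) -> u = v.
Proof.
move=> p; apply/val_inj/esym.
exact: par_uniq (D_line u) (D_line v) (D_line u) p (par_refl _) (D_o v) (D_o u).
Qed.

Lemma D_at x (u : D) : exists m, [/\ is_line m, par m (val u) & x \in m].
Proof. by have [m [im pm xm]] := par_exists x (D_line u); exists m; split=> //; apply: par_sym. Qed.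

Lemma affine_affine_geometry : affine_geometry delta lnD.
Proof.
have nD (u v : D) : u != v -> val u != val v by rewrite (inj_eq val_inj).
split.
- move=> a b; have [->//|nab] := eqVneq a b.
  by apply/esym/affine_delta_uniq; rewrite 1?eq_sym // lineC; apply: deltaP.
- move=> u; apply/setP=> w; rewrite !inE setUid; have /andP[/flatP -> _] := D_line u.
  apply/idP/eqP => [wu|->//]; apply/val_inj/line_subset_eq => //; exact: D_line.
- by move=> u v; rewrite inE; apply: subset_trans (sub_cl M _); apply: subsetUl.
- by move=> u v; apply/setP=> w; rewrite !inE setUC.
- move=> u v w; rewrite inE => wL nwu; apply/setP=> x; rewrite !inE.
  suff -> : cl M (val u :|: val w) = cl M (val u :|: val v) by [].
  have nuv : u != v.
    apply: contraNneq nwu => uv; apply/eqP/val_inj/line_subset_eq; rewrite ?D_line //.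
    by move: wL; rewrite -uv setUid; have /andP[/flatP -> _] := D_line u.
  apply: (flat_rk_eq (flat_cl M _) (flat_cl M _)).
    rewrite cl_sub ?flat_cl // subUset wL andbT.
    by apply: subset_trans (sub_cl M _); apply: subsetUl.
  rewrite (rk_two_lines (D_line u) (D_line v) (D_o u) (D_o v) (nD _ _ nuv)).
  by rewrite (rk_two_lines (D_line u) (D_line w) (D_o u) (D_o w)) // nD // eq_sym.
- move=> a b c nab nbc nac; rewrite inE.
  set u := delta a b; set v := delta b c; set w := delta a c.
  have iab := is_line_line nab; have ibc := is_line_line nbc; have iac := is_line_line nac.
  have [cl_ab|cab] := boolP (c \in line a b).
    have -> : w = u.
      by apply: (affine_delta_uniq nac); rewrite -(line_of iab (line_l _ _ _) cl_ab nac); apply: deltaP.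
    by apply: subset_trans (sub_cl M _); apply: subsetUl.
  have nl : line a b != line b c by apply: contraNneq cab => ->; rewrite line_r.
  (* [par_plane] asks for three concurrent lines, so [a c] is replaced by its parallel through
     [b]. *)
  have [m [im pm bm]] := par_exists b iac.
  apply: (@par_plane (line a b) (line b c) m _ _ _ b o); rewrite ?D_line ?D_o ?line_l ?line_r //.
  + exact: deltaP.
  + exact: deltaP.
  + by apply: par_trans (par_sym pm) _; rewrite ?D_line //; apply: deltaP.
  have s1' : line a b \subset cl M (line a b :|: line b c).
    by apply: subset_trans (sub_cl M _); apply: subsetUl.
  have s2' : line b c \subset cl M (line a b :|: line b c).
    by apply: subset_trans (sub_cl M _); apply: subsetUr.
  apply: (par_in iac (flat_cl M _) _ pm bm); last by rewrite (subsetP s1') ?line_r.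
  exact: line_sub (flat_cl M _) (subsetP s1' a (line_l _ _ _)) (subsetP s2' c (line_r _ _ _)).
- move=> v w a b nvw nab; rewrite inE => uL.
  have [la [ila pla ala]] := D_at a v; have [ma [ima pma ama]] := D_at a w.
  have [lb [ilb plb blb]] := D_at b w.
  have iab := is_line_line nab.
  (* The plane of [v] and [w] at [o] is carried to the parallel plane at [a]. It contains [la] and
     [lb], which have different directions and therefore meet. *)
  have sP : line a b \subset cl M (la :|: ma).
    exact: (par_plane (D_line v) (D_line w) (D_line (delta a b)) ila ima iab (D_o v) (D_o w)
      (D_o _) ala ama (line_l _ _ _) (par_sym pla) (par_sym pma) (par_sym (deltaP nab)) (nD _ _ nvw) uL).
  have nlm : la != ma.
    apply: contraNneq nvw => e; apply/eqP/par_D.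
    by apply: par_trans (par_sym pla) _; rewrite ?D_line // e.
  have mP : ma \subset cl M (la :|: ma) by apply: subset_trans (sub_cl M _); apply: subsetUr.
  have lP : la \subset cl M (la :|: ma) by apply: subset_trans (sub_cl M _); apply: subsetUl.
  have pml : par ma lb by apply: par_trans pma _; rewrite ?D_line //; apply: par_sym.
  have lbP : lb \subset cl M (la :|: ma).
    by apply: (par_in ima (flat_cl M _) mP pml blb); rewrite (subsetP sP) ?line_r.
  have [d|] := boolP [disjoint la & lb].
    case/negP: nvw; apply/eqP/par_D; apply: par_trans (par_sym pla) _; rewrite ?D_line //.
    apply: par_trans (_ : par la lb) plb; rewrite ?D_line //; right; split=> //.
    by exists (cl M (la :|: ma)); rewrite flat_cl (rk_two_lines ila ima ala ama nlm).
  rewrite -setI_eq0 => /set0Pn[c]; rewrite inE => /andP[cla clb]; exists c; split.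
    by have [->|nac] := eqVneq a c; [left|right; apply: delta_par pla].
  by have [->|nbc] := eqVneq b c; [left|right; apply: delta_par plb].
- move=> a u; have [m [im pm am]] := D_at a u; have [b bm nba] := line_other a im.
  by exists b; rewrite 1?eq_sym //; apply: delta_par pm; rewrite // eq_sym.
move=> u v; have /subsetPn[x _ xL] : ~~ ([set: T] \subset cl M (val u :|: val v)).
  apply/negP=> /(rkS M); rewrite rk_setT; case: pmd => -> _.
  have [<-|nuv] := eqVneq u v.
    by rewrite setUid rk_cl; have /andP[_ /eqP ->] := D_line u; lia.
  by rewrite (rk_two_lines (D_line u) (D_line v) (D_o u) (D_o v) (nD _ _ nuv)); lia.
have nox : o != x.
  apply: contraNneq xL => <-; rewrite (subsetP (sub_cl M _)) // inE D_o //.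
have Px : is_line (line o x) && (o \in line o x) by rewrite is_line_line // line_l.
exists (Sub (line o x) Px); rewrite inE /=; apply: contra xL => /subsetP; apply.
exact: line_r.
Qed.

Lemma affine_card_delta a u : #|[set x | on delta [set u] a x]| = q.
Proof.
have [m [im pm am]] := D_at a u; rewrite -(card_line im); apply: eq_card => x.
rewrite inE /on in_set1; have [<-|nax] := eqVneq a x; first by rewrite am.
apply/eqP/idP => [e|xm]; last exact: delta_par pm.
have p : par (val u) (line a x) by rewrite -e; apply/par_sym/deltaP.
rewrite (par_uniq (D_line u) im (is_line_line nax) (par_sym pm) p am (line_l _ _ _)).
exact: line_r.
Qed.

End Directions.

(** A flat through [a], [b] and [c] contains the parallel to [a b] through [c]; in coordinates this
    is the closure condition of [ag_flat]. *)
Lemma ag_isomorphic : isomorphic M (AG F k).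
Proof.
have cT : #|T| = q ^ k := pmd_card pmd.
have [o _] : exists o : T, o \in T.
  by apply/card_gt0P; rewrite cT expn_gt0 (ltnW q1).
have /fin_all_exists[de deP] a := fin_all_exists (affine_dir_exists o a).
have ag := affine_affine_geometry deP.
have [f [fb fP]] := affine_coordinates ag (affine_card_delta deP) cT.
have inj_f := bij_inj fb; have [f' _ f'K] := fb.
apply: (pmd_isomorphic pmd (ag_pmd F k) fb) => A fA; apply: ag_flat => x y z t.
case/imsetP=> a aA ->; case/imsetP=> b bA ->; case/imsetP=> c cA ->.
have [->|nab] := eqVneq a b; first by rewrite subrr scaler0 addr0 imset_f.
rewrite -(f'K (f c + _)%R); set d := f' _; apply: imset_f.
have [<-//|ncd] := eqVneq c d.
have e : (f d - f c = t *: (f b - f a))%R by rewrite f'K addrAC subrr add0r.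
have /(delta_eq_par deP nab ncd) p : de a b = de c d by apply/fP => //; exists t.
have lA : line a b \subset A by apply: line_sub.
exact: (subsetP (par_in (is_line_line nab) fA lA p (line_l _ _ _) cA)) (line_r _ _ _).
Qed.

End AffineUniqueness.

(** Sizes 0 and 1 in ranks 0 and 1 make [M] simple, so the bound for all matroids of this rank and
    size is attained within the simple ones, and its equality case carries over. *)
Lemma pmd_unique_maximizer (T : finType) (M : matroid T) r s :
  perfect_matroid_design M r s -> s 0 = 0 -> s 1 = 1 ->
  (forall (U : finType) (N : matroid U), perfect_matroid_design N r s -> isomorphic N M) ->
  unique_maximizer (fun U (N : matroid U) => chain_count N r s)
    (simple_rank_size_class r (s r)) M.
Proof.
move=> p s0 s1 uniq; have inM : simple_rank_size_class r (s r) M.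
  by split; [apply: pmd_simple p s0 s1|split; [case: p|apply: pmd_card p]].
split=> [|U N [[_ [rN cN]] mx]].
  by split=> // U N [_ [rN cN]]; case: (chain_count_max_pmd p rN cN).
have [le eq_pmd] := chain_count_max_pmd p rN cN.
by apply/uniq/eq_pmd/eqP; rewrite eqn_leq le mx.
Qed.

Theorem theorem3p2 :
  (forall (r : nat) (alpha : nat -> nat),
     (exists (T0 : finType) (M0 : matroid T0),
        perfect_matroid_design M0 r alpha) ->
     forall (T : finType) (M : matroid T),
       perfect_matroid_design M r alpha <->
       maximizes (fun U (N : matroid U) => chain_count N r alpha)
                 (rank_size_class r (alpha r)) M) /\
  (forall (r q : nat) (F : finFieldType),
     4 <= r -> prime_power q -> #|F| = q ->
     unique_maximizer (fun U (N : matroid U) => chain_count N r (pg_sizes q))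
       (simple_rank_size_class r ((q ^ r - 1) %/ (q - 1))) (PG F r.-1) /\
     unique_maximizer (fun U (N : matroid U) => chain_count N r (ag_sizes q))
       (simple_rank_size_class r (q ^ r.-1)) (AG F r.-1)).
Proof.
split=> [r alpha [T0 [M0 p0]] T M|r q F r4 _ cF]; first exact: pmd_iff_maximizes p0.
case: r r4 => // k k3; rewrite -{q}cF; have q1 := finNzRing_gt1 F.
split.
  apply: (pmd_unique_maximizer (pg_pmd F k) (pg_sizes0 _)) => [|U N].
    by rewrite pg_sizesS // pg_sizes0 muln0.
  exact: pg_isomorphic.
by apply: (pmd_unique_maximizer (ag_pmd F k)) => // U N; apply: ag_isomorphic.
Qed.
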